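(* Let $m\ge1$, let $L(k)$ be the operator bunch described in the context, and let $k\in S_\nu$ for some $\nu\in\{0,\dots,2m-1\}$, $\operatorname{Im}k\ne0$. Then $k$ is an eigenvalue of the bunch $L(k)$ if and only if $$W_\nu(k)=\det\left(f^{(l)}_{\tau_q}(0,k)\right)_{l,q=0}^{m-1}=0,$$ where $\tau_0,\dots,\tau_{m-1}$ are the $m$ indices $\tau\in\{0,\dots,2m-1\}$ with $\operatorname{Im}(k\omega_\tau)>0$ for $k\in S_\nu$, and $f^{(l)}$ denotes the $l$-th derivative in $x$.
   Context: Let $\omega_j=\exp(ij\pi/m)$ and $k_{nj\tau}=-\dfrac{in}{\omega_\tau(1-\omega_j)}$ for $n\ge1$, $1\le j\le2m-1$, $0\le\tau\le2m-1$. Let $p_{\gamma s n}\in\mathbb{C}$ ($0\le\gamma\le2m-2$, $0\le s\le2m-\gamma-1$, $n\ge1$) satisfy $\sum_{\gamma,s,n}n^{\gamma+s}|p_{\gamma s n}|<\infty$, and put $p_\gamma(x,k)=\sum_{s=0}^{2m-\gamma-1}\sum_{n=1}^\infty p_{\gamma s n}k^se^{-nx}$. The operator bunch (pencil) $L(k)$ is generated in $L_2[0,\infty)$ by $$l(y)=(-1)^my^{(2m)}(x)+\sum_{\gamma=0}^{2m-2}p_\gamma(x,k)y^{(\gamma)}(x)-k^{2m}y(x)$$ with boundary conditions $y^{(j)}(0)=0$, $j=0,\dots,m-1$. A number $k\in\mathbb{C}$ is an eigenvalue of the bunch if there is a nonzero $y\in L_2[0,\infty)$ with $l(y)=0$ satisfying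 these boundary conditions. The special solutions $f_\tau(x,k)$, $\tau=0,\dots,2m-1$, $k\ne k_{nj\tau}$, of $l(y)=0$ are those of the form $$f_\tau(x,k)=e^{ik\omega_\tau x}+\sum_{\alpha=1}^\infty V_\alpha^{(\tau)}e^{(-\alpha+ik\omega_\tau)x}+\sum_{j=1}^{2m-1}\sum_{\alpha=1}^\infty\sum_{n=1}^\alpha\frac{V_{n\alpha}^{(j,\tau)}}{in+k\omega_\tau(1-\omega_j)}e^{(-\alpha+ik\omega_\tau)x},$$ with numbers $V_\alpha^{(\tau)},V_{n\alpha}^{(j,\tau)}$ independent of $x,k$ for which the series $\sum_{j}\sum_n\frac1n\sum_{\alpha\ge n}\alpha^{2m-1}(\alpha-n)|V_{n\alpha}^{(j,\tau)}|$, $\sum_j\sum_\alpha\alpha^{2m-1}|V_{\alpha\alpha}^{(j,\tau)}|$, $\sum_\alpha\alpha^{2m}|V_\alpha^{(\tau)}|$ converge. Such solutions exist and their coefficients are uniquely determined by the $p_{\gamma s n}$ (established earlier in the paper). Sectors: $S_\nu=\{k\in\mathbb{C}\setminus\{0\}:\nu\pi/m<\arg k<(\nu+1)\pi/m\}$, $\nu=0,\dots,2m-1$. In $S_\nu$ the sign of $\operatorname{Im}(k\omega_\tau)$ is constant for each $\tau$; it is positive for exactly $m$ indices $\tau$ (for these $f_\tau(\cdot,k)\in L_2[0,\infty)$) and negative for the other $m$. The ordering of the columns of $W_\nu$ affects only its sign. *)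

(* Defs.v *)
From HB Require Import structures.
From mathcomp Require Import all_boot all_order all_algebra.
From mathcomp Require Import all_classical all_reals all_analysis.
From mathcomp Require Import complex.

Set Implicit Arguments.
Unset Strict Implicit.
Unset Printing Implicit Defensive.

Import Order.TTheory GRing.Theory Num.Theory.
Import numFieldNormedType.Exports.

Local Open Scope classical_set_scope.
Local Open Scope ring_scope.
Local Open Scope complex_scope.

(* The reals are an arbitrary [R : realType] and the complex numbers are
   [R[i]]. [R[i]] carries no topology here, so limits of complex-valued
   functions and sums of complex series are taken on real and imaginary
   parts. *)

Section ComplexAnalysis.
Context {R : realType}.
Implicit Types (y : R -> R[i]) (x : R).

Definition cexp (z : R[i]) : R[i] :=
  (expR (complex.Re z) * cos (complex.Im z)) +i*
  (expR (complex.Re z) * sin (complex.Im z)).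

Definition cseries (u : nat -> R[i]) : R[i] :=
  (\big[+%R/0]_(1 <= n <oo) complex.Re (u n)) +i*
  (\big[+%R/0]_(1 <= n <oo) complex.Im (u n)).

(* A function on the half-line is a [y : R -> R[i]] of which only the values
   at [x >= 0] matter: difference quotients use only points of the half-line,
   so derivatives are two-sided at [x > 0] and one-sided at [x = 0]. *)
Definition half_nbhs x : set_system R := within `[0, +oo[ x^'.

Definition dquot (g : R -> R) x (t : R) : R := (g t - g x) / (t - x).

Definition half_derivable y x : Prop :=
  cvg (dquot (fun t => complex.Re (y t)) x t @[t --> half_nbhs x]) /\
  cvg (dquot (fun t => complex.Im (y t)) x t @[t --> half_nbhs x]).

Definition half_deriv y x : R[i] :=
  lim (dquot (fun t => complex.Re (y t)) x t @[t --> half_nbhs x]) +i*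
  lim (dquot (fun t => complex.Im (y t)) x t @[t --> half_nbhs x]).

Definition half_derivn (n : nat) y : R -> R[i] := iter n half_deriv y.

Definition half_nderivable (n : nat) y : Prop :=
  forall i x, (i < n)%N -> 0 <= x -> half_derivable (half_derivn i y) x.

Definition in_L2 y : Prop :=
  [/\ measurable_fun (`[0, +oo[ : set R) (fun x => complex.Re (y x)),
      measurable_fun (`[0, +oo[ : set R) (fun x => complex.Im (y x)) &
      (\int[@lebesgue_measure R]_(x in `[0%R, +oo[)
         ((Normc.normc (y x)) ^+ 2)%:E < +oo)%E].

End ComplexAnalysis.

Section Pencil.
Context {R : realType}.
Variable m : nat.

Definition omega (j : nat) : R[i] := cexp ('i * (j%:R * pi / m%:R)%:C).

Definition knjt (n j tau : nat) : R[i] :=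
  - ('i * n%:R / (omega tau * (1 - omega j))).

Definition sector (nu : nat) : set R[i] := [set k |
  exists r theta : R, [/\ 0 < r,
    nu%:R * pi / m%:R < theta, theta < nu.+1%:R * pi / m%:R &
    k = r%:C * cexp ('i * theta%:C)]].

(* [p gamma s n] is used for [gamma <= 2m-2], [s <= 2m-gamma-1], [n >= 1]. *)
Variable p : nat -> nat -> nat -> R[i].

Definition p_summable : Prop :=
  (\sum_(gamma < (2 * m).-1) \sum_(s < 2 * m - gamma) \sum_(1 <= n <oo)
     (n%:R ^+ (gamma + s) * Normc.normc (p gamma s n))%:E < +oo)%E.

Definition pcoef (gamma : nat) (x : R) (k : R[i]) : R[i] :=
  \sum_(s < 2 * m - gamma)
    cseries (fun n => p gamma s n * k ^+ s * cexp (- (n%:R * x)%:C)).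

Definition lexpr (k : R[i]) (y : R -> R[i]) (x : R) : R[i] :=
  (-1) ^+ m * half_derivn (2 * m) y x
  + \sum_(gamma < (2 * m).-1) pcoef gamma x k * half_derivn gamma y x
  - k ^+ (2 * m) * y x.

Definition solves (k : R[i]) (y : R -> R[i]) : Prop :=
  half_nderivable (2 * m) y /\ forall x, 0 <= x -> lexpr k y x = 0.

Definition bunch_eigenvalue (k : R[i]) : Prop :=
  exists y : R -> R[i], [/\ exists2 x : R, 0 <= x & y x != 0,
    in_L2 y,
    solves k y &
    forall j, (j < m)%N -> half_derivn j y 0 = 0].

(* [V tau alpha] and [U j tau n alpha] are the coefficients
   $V_\alpha^{(\tau)}$ and $V_{n\alpha}^{(j,\tau)}$. *)
Variables (V : nat -> nat -> R[i]) (U : nat -> nat -> nat -> nat -> R[i]).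

Definition fsol (tau : nat) (k : R[i]) (x : R) : R[i] :=
  let E alpha := cexp ((- alpha%:R + 'i * k * omega tau) * x%:C) in
  cexp ('i * k * omega tau * x%:C)
  + cseries (fun alpha => V tau alpha * E alpha)
  + \sum_(1 <= j < 2 * m) cseries (fun alpha => \sum_(1 <= n < alpha.+1)
      U j tau n alpha / ('i * n%:R + k * omega tau * (1 - omega j))
      * E alpha).

Definition coef_summable (tau : nat) : Prop :=
  [/\ (\sum_(1 <= j < 2 * m) \sum_(1 <= n <oo)
         ((n%:R^-1)%:E * \sum_(n <= alpha <oo)
           (alpha%:R ^+ (2 * m).-1 * (alpha - n)%:R
            * Normc.normc (U j tau n alpha))%:E) < +oo)%E,
      (\sum_(1 <= j < 2 * m) \sum_(1 <= alpha <oo)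
         (alpha%:R ^+ (2 * m).-1
          * Normc.normc (U j tau alpha alpha))%:E < +oo)%E &
      (\sum_(1 <= alpha <oo)
         (alpha%:R ^+ (2 * m) * Normc.normc (V tau alpha))%:E < +oo)%E].

Definition special_solutions : Prop :=
  forall tau, (tau < 2 * m)%N ->
    coef_summable tau /\
    forall k : R[i],
      (forall n j, (1 <= n)%N -> (1 <= j < 2 * m)%N -> k != knjt n j tau) ->
      solves k (fsol tau k).

(* [t] enumerates, in any order, the indices [tau] with [Im (k * omega_tau) > 0]
   on the sector of index [nu]. *)
Definition decaying_indices (nu : nat) (t : 'I_m -> 'I_(2 * m)) : Prop :=
  injective t /\
  forall k, sector nu k ->
    forall tau : 'I_(2 * m),
      (tau \in codom t) = (0 < complex.Im (k * omega tau)).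

Definition Wdet (t : 'I_m -> 'I_(2 * m)) (k : R[i]) : R[i] :=
  \det (\matrix_(l < m, q < m) half_derivn l (fsol (t q) k) 0).

End Pencil.

(* Main.v *)
Require Import Defs.
From mathcomp Require Import all_boot all_order all_algebra.
From mathcomp Require Import all_classical all_reals all_analysis.
From mathcomp Require Import complex.
From mathcomp Require Import measurable_realfun ring lra.

(** Put a_tau = i k omega_tau. A solution of l(y) = 0 is a sum y = sum_tau z_tau
   of modal coordinates with z_tau' = a_tau z_tau + O(e^{-x} |z|), because the
   coefficients p_gamma are O(e^{-x}), and no a_tau is purely imaginary in an
   open sector. Let Q be the sum of |z_tau|^2 over the growing modes minus the
   sum over the decaying modes. For large x it is nondecreasing, so if it is
   ever positive, |z| stays bounded below. Sampling y at 2m equally spaced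
   points recovers z up to a Vandermonde matrix and an O(e^{-x}) error, so then
   y is not in L_2. Hence Q <= 0 from some x_0 on for every L_2 solution, and an
   L_2 solution whose m decaying coordinates vanish at x_0 is zero. Applied to
   a combination of an eigenfunction y and the m decaying f_tau, this puts y in
   the span of the f_tau; these are independent by their asymptotics
   e^{a_tau x} (1 + O(e^{-x})) and the same sampling. The growing f_tau, which
   may have poles at the given k, are never used. *)

Set Implicit Arguments.
Unset Strict Implicit.
Unset Printing Implicit Defensive.

Import Order.TTheory GRing.Theory Num.Theory.
Import numFieldNormedType.Exports Normc.

Local Open Scope classical_set_scope.
Local Open Scope ring_scope.
Local Open Scope complex_scope.

(** * Complex numbers *)

Section ComplexNorm.
Context {R : realType}.
Implicit Types (z w : R[i]) (x a b : R).
Local Notation Re := (@complex.Re R).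
Local Notation Im := (@complex.Im R).

(** Square integrability controls y but none of its derivatives, so z(x) cannot be read off from y
    at the single point x; values at shifted points take the place of the derivatives. No
    asymptotics are derived for a general solution: the sign of one quadratic form is enough. The
    point x_0 depends on k and p only, because it has to be fixed before the solution is known:
    among the m + 1 functions y and the decaying f_tau, some nontrivial combination w has its m
    decaying coordinates zero at x_0. Then w = 0, and the derivatives of w at 0, to which y
    contributes nothing by the boundary conditions, give a null vector of the matrix of W_nu,
    nonzero because y is. Independence of the f_tau serves the converse, where it makes the
    combination built from a null vector a nonzero function. *)

Lemma Re_add z w : Re (z + w) = Re z + Re w. Proof. by case: z; case: w. Qed.
Lemma Im_add z w : Im (z + w) = Im z + Im w. Proof. by case: z; case: w. Qed.
Lemma Re_opp z : Re (- z) = - Re z. Proof. by case: z. Qed.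
Lemma Im_opp z : Im (- z) = - Im z. Proof. by case: z. Qed.
Lemma Re_mul z w : Re (z * w) = Re z * Re w - Im z * Im w.
Proof. by case: z; case: w. Qed.
Lemma Im_mul z w : Im (z * w) = Re z * Im w + Im z * Re w.
Proof. by case: z; case: w. Qed.

Lemma complexP z w : Re z = Re w -> Im z = Im w -> z = w.
Proof. by case: z => ? ?; case: w => ? ? /= -> ->. Qed.

Lemma normc_ge0 z : 0 <= normc z.
Proof. by case: z => a b; rewrite sqrtr_ge0. Qed.

Lemma sqr_normcE z : normc z ^+ 2 = Re z ^+ 2 + Im z ^+ 2.
Proof. by case: z => a b /=; rewrite sqr_sqrtr // addr_ge0 // sqr_ge0. Qed.

Lemma normcD z w : normc (z + w) <= normc z + normc w.
Proof. exact: (@ler_normD _ (Rcomplex R)). Qed.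

Lemma normc_eq0 z : (normc z == 0) = (z == 0).
Proof.
apply/eqP/eqP => [|->]; [exact: eq0_normc|exact: normc0].
Qed.

Lemma normc_opp z : normc (- z) = normc z.
Proof. exact: (@normrN _ (Rcomplex R)). Qed.

Lemma normcX z n : normc (z ^+ n) = normc z ^+ n.
Proof.
elim: n => [|n IH]; first by rewrite !expr0 normc1.
by rewrite !exprS normcM IH.
Qed.

Lemma normc_sum (I : Type) (r : seq I) (P : pred I) (F : I -> R[i]) :
  normc (\sum_(i <- r | P i) F i) <= \sum_(i <- r | P i) normc (F i).
Proof.
elim/big_ind2 : _ => // [|z a w b za wb]; first by rewrite normc0.
by apply: le_trans (normcD _ _) _; exact: lerD.
Qed.

Lemma ler_Re_normc z : `|Re z| <= normc z.
Proof.
rewrite -(ler_pXn2r (n := 2)) ?nnegrE ?normc_ge0 //.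
by rewrite real_normK ?num_real // sqr_normcE lerDl sqr_ge0.
Qed.

Lemma ler_Im_normc z : `|Im z| <= normc z.
Proof.
rewrite -(ler_pXn2r (n := 2)) ?nnegrE ?normc_ge0 //.
by rewrite real_normK ?num_real // sqr_normcE lerDr sqr_ge0.
Qed.

Lemma ler_normc_ReIm z : normc z <= `|Re z| + `|Im z|.
Proof.
rewrite -(ler_pXn2r (n := 2)) ?nnegrE ?normc_ge0 ?addr_ge0 //.
rewrite sqr_normcE sqrrD !real_normK ?num_real //.
by rewrite -addrA lerD2l lerDr mulrn_wge0 // mulr_ge0.
Qed.

Lemma normc_real x : normc x%:C = `|x|.
Proof. by rewrite /= expr0n addr0 sqrtr_sqr. Qed.

Lemma normc_cexp z : normc (cexp z) = expR (Re z).
Proof.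
rewrite /cexp /= !exprMn -mulrDr cos2Dsin2 mulr1 sqrtr_sqr.
by rewrite ger0_norm ?expR_ge0.
Qed.

Lemma cexpD z w : cexp (z + w) = cexp z * cexp w.
Proof.
apply: complexP; rewrite /cexp Re_add Im_add ?Re_mul ?Im_mul /=;
  rewrite expRD ?cosD ?sinD; ring.
Qed.

Lemma cexp0 : cexp 0 = 1 :> R[i].
Proof. by apply: complexP; rewrite /cexp /= expR0 ?cos0 ?sin0 ?mul1r. Qed.

Lemma cexpX z n : cexp (z *+ n) = cexp z ^+ n.
Proof.
elim: n => [|n IH]; first by rewrite mulr0n cexp0.
by rewrite mulrS cexpD IH exprS.
Qed.

Lemma cexp_neq0 z : cexp z != 0.
Proof. by rewrite -normc_eq0 normc_cexp gt_eqF // expR_gt0. Qed.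

Lemma cexpN z : cexp (- z) = (cexp z)^-1.
Proof.
apply: (mulfI (cexp_neq0 z)); rewrite -cexpD subrr cexp0 divff //.
exact: cexp_neq0.
Qed.

(** Half-angle formula: 1 - cos t = 2 sin^2 (t/2), and t/2 lies in ]0, pi[ for t = |x|. *)
Lemma cos_lt1 x : 0 < `|x| < 2 * pi -> cos x < 1.
Proof.
move=> /andP[x0 x2].
have -> : cos x = cos `|x| by case: (ger0P x) => // _; rewrite cosN.
set t := `|x| in x0 x2 *.
rewrite (_ : t = (t / 2) *+ 2); last by rewrite -mulr_natr divfK.
have : 0 < sin (t / 2).
  by apply: sin_gt0_pi; rewrite divr_gt0 //= ltr_pdivrMr // mulrC.
by move/(exprn_gt0 2); rewrite cos_mulr2n cos2sin2; lra.
Qed.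

Lemma cexp_inj z w : `|Im (z - w)| < 2 * pi -> cexp z = cexp w -> z = w.
Proof.
move=> Hpi H; apply/eqP; rewrite -subr_eq0.
have E : cexp (z - w) = 1 by rewrite cexpD cexpN H divff ?cexp_neq0.
have R0 : Re (z - w) = 0.
  by apply: expR_inj; rewrite -normc_cexp E expR0 normc1.
have I0 : Im (z - w) = 0.
  apply/eqP; rewrite -normr_eq0; apply: contraT => n0.
  have /cos_lt1 : 0 < `|Im (z - w)| < 2 * pi by rewrite Hpi lt_def n0 normr_ge0.
  have := congr1 Re E; rewrite /cexp /= R0 expR0 mul1r => ->; by rewrite ltxx.
by apply/eqP/complexP; rewrite ?R0 ?I0.
Qed.

(** Quantitative injectivity. K is the sum of the moduli of the entries of the inverse; it is fixed
    before v, so it stays the same when v depends on x. *)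
Lemma invertible_coercive n (A : 'M[R[i]]_n) : A \in unitmx ->
  exists2 K : R, 0 <= K & forall v : 'I_n -> R[i],
    \sum_i normc (v i) <= K * \sum_j normc (\sum_i A j i * v i).
Proof.
move=> uA; set B := invmx A.
exists (\sum_i \sum_j normc (B i j)).
  by apply: sumr_ge0 => i _; apply: sumr_ge0 => j _; exact: normc_ge0.
move=> v; set S := \sum_j _.
have vE i : v i = \sum_j B i j * \sum_l A j l * v l.
  have : \col_i v i = B *m (A *m \col_i v i) by rewrite mulmxA mulVmx // mul1mx.
  move=> /matrixP/(_ i 0); rewrite !mxE => ->; apply: eq_bigr => j _.
  by rewrite !mxE; congr (_ * _); apply: eq_bigr => l _; rewrite mxE.
rewrite mulr_suml; apply: ler_sum => i _; rewrite mulr_suml {1}vE.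
apply: (le_trans (normc_sum _ _ _)); apply: ler_sum => j _.
rewrite normcM ler_wpM2l ?normc_ge0 // /S [leRHS](bigD1 j) //= lerDl.
by apply: sumr_ge0 => ? _; exact: normc_ge0.
Qed.

Lemma Vandermonde_unit n (a : 'I_n -> R[i]) : injective a ->
  (\matrix_(j < n, i < n) a i ^+ j) \in unitmx.
Proof.
move=> inj.
have -> : (\matrix_(j < n, i < n) a i ^+ j) = Vandermonde n (\row_i a i).
  by apply/matrixP => i j; rewrite !mxE.
rewrite unitmxE det_Vandermonde unitfE.
apply/prodf_neq0 => i _; apply/prodf_neq0 => j ij.
by rewrite !mxE subr_eq0; apply: contraTneq ij => /inj ->; rewrite ltnn.
Qed.

End ComplexNorm.

(** * Derivatives on the half-line *)

Section HalfDerivatives.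
Context {R : realType}.
Implicit Types (x t : R) (g : R -> R) (y : R -> R[i]) (d : R[i]).
Local Notation Re := (@complex.Re R).
Local Notation Im := (@complex.Im R).

(** A relational derivative: [lim] is total, so its value alone does not tell whether the limit
    exists. The relation carries existence and value together. *)
Definition is_hder g x (l : R) := dquot g x t @[t --> half_nbhs x] --> l.

Definition is_chder y x d :=
  is_hder (fun t => Re (y t)) x (Re d) /\ is_hder (fun t => Im (y t)) x (Im d).

(** Properness gives uniqueness of limits, hence of half-line derivatives. The point x + e/2 lies on
    the right of x, so x = 0 is included. *)
Lemma half_nbhs_proper x : 0 <= x -> ProperFilter (half_nbhs x).
Proof.
move=> x0; apply: Build_ProperFilter => -[e /= e0 H].
have e2 : 0 < e / 2 by rewrite divr_gt0.
apply: (H (x + e / 2)) => /=.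
- by rewrite opprD addNKr normrN gtr0_norm // ltr_pdivrMr // ltr_pMr // ltr1n.
- by rewrite gt_eqF // ltrDl.
- by rewrite in_itv /= andbT addr_ge0 // ltW.
Qed.

Lemma near_half_nbhs x (P : set R) :
  half_nbhs x P <-> \forall t \near x, t != x -> 0 <= t -> P t.
Proof.
split=> H; apply: (@filterS _ (nbhs x) _ _ _ _ H) => t Ht tx.
  by move=> t0; apply: Ht => //; rewrite /= in_itv /= andbT.
by rewrite /= in_itv /= andbT; exact: Ht.
Qed.

Lemma half_derivableP y x : half_derivable y x -> is_chder y x (half_deriv y x).
Proof. by move=> [? ?]; split. Qed.

Lemma is_hder_cvg g x l : 0 <= x -> is_hder g x l ->
  lim (dquot g x t @[t --> half_nbhs x]) = l.
Proof.
move=> x0 H; have := half_nbhs_proper x0 => ?.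
by apply/cvg_lim => //; exact: Rhausdorff.
Qed.

Lemma is_chderP y x d : 0 <= x -> is_chder y x d ->
  half_derivable y x /\ half_deriv y x = d.
Proof.
move=> x0 [H1 H2]; split.
  by split; apply/cvg_ex; [exists (Re d)|exists (Im d)].
by rewrite /half_deriv (is_hder_cvg x0 H1) (is_hder_cvg x0 H2); case: d {H1 H2}.
Qed.

Lemma eq_is_hder g1 g2 x l : 0 <= x -> (forall t, 0 <= t -> g1 t = g2 t) ->
  is_hder g1 x l -> is_hder g2 x l.
Proof.
move=> x0 E; rewrite /is_hder; apply: cvg_trans; apply: near_eq_cvg.
apply/near_half_nbhs; near=> t => tx t0.
by rewrite /dquot E // E.
Unshelve. all: by end_near. Qed.

Lemma eq_is_chder y1 y2 x d : 0 <= x -> (forall t, 0 <= t -> y1 t = y2 t) ->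
  is_chder y1 x d -> is_chder y2 x d.
Proof.
by move=> x0 E [H1 H2]; split; [move: H1|move: H2]; apply: eq_is_hder => // t t0;
  rewrite E.
Qed.

Lemma is_hder_lin g1 g2 x l1 l2 (a b : R) : is_hder g1 x l1 -> is_hder g2 x l2 ->
  is_hder (fun t => a * g1 t + b * g2 t) x (a * l1 + b * l2).
Proof.
move=> H1 H2; rewrite /is_hder.
rewrite (_ : dquot _ x = fun t => a * dquot g1 x t + b * dquot g2 x t); last first.
  by apply/funext => t; rewrite /dquot; ring.
by apply: cvgD; apply: cvgMr.
Qed.

Lemma is_chder0 x : is_chder (fun=> 0) x 0.
Proof.
suff H : is_hder (fun=> 0) x 0 by split.
rewrite /is_hder (_ : dquot _ x = fun=> 0); first exact: cvg_cst.
by apply/funext => t; rewrite /dquot subrr mul0r.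
Qed.

Lemma is_chderD y1 y2 x d1 d2 : is_chder y1 x d1 -> is_chder y2 x d2 ->
  is_chder (fun t => y1 t + y2 t) x (d1 + d2).
Proof.
move=> [H1 H2] [H3 H4]; split.
  have := is_hder_lin (a := 1) (b := 1) H1 H3; rewrite Re_add !mul1r.
  congr (is_hder _ _ _).
  by apply/funext => t; rewrite Re_add !mul1r.
have := is_hder_lin (a := 1) (b := 1) H2 H4; rewrite Im_add !mul1r.
congr (is_hder _ _ _).
by apply/funext => t; rewrite Im_add !mul1r.
Qed.

Lemma is_chderZ y x d c : is_chder y x d -> is_chder (fun t => c * y t) x (c * d).
Proof.
move=> [H1 H2]; split.
  have := is_hder_lin (a := Re c) (b := - Im c) H1 H2; rewrite Re_mul mulNr.
  congr (is_hder _ _ _).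
  by apply/funext => t; rewrite Re_mul mulNr.
have := is_hder_lin (a := Re c) (b := Im c) H2 H1; rewrite Im_mul.
congr (is_hder _ _ _).
by apply/funext => t; rewrite Im_mul.
Qed.

Lemma is_chder_comb (I : Type) (r : seq I) (c : I -> R[i]) (g : I -> R -> R[i]) x
    (d : I -> R[i]) :
  (forall i, is_chder (g i) x (d i)) ->
  is_chder (fun t => \sum_(i <- r) c i * g i t) x (\sum_(i <- r) c i * d i).
Proof.
move=> H; elim: r => [|i r IH].
  rewrite big_nil (_ : (fun t => _) = fun=> 0); first exact: is_chder0.
  by apply/funext => t; rewrite big_nil.
rewrite big_cons (_ : (fun t => _) =
  fun t => c i * g i t + \sum_(i <- r) c i * g i t); last first.
  by apply/funext => t; rewrite big_cons.
by apply: is_chderD => //; exact: is_chderZ.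
Qed.

(** At x < 0 the filter [half_nbhs] is degenerate and [half_deriv] meaningless, so the formulas hold
    on x >= 0 only and each differentiation passes through [eq_is_chder]. *)
Lemma half_derivn_comb (I : Type) (r : seq I) (c : I -> R[i]) (g : I -> R -> R[i]) n :
  (forall i, half_nderivable n (g i)) ->
  let w t := \sum_(i <- r) c i * g i t in
  half_nderivable n w /\
  forall j x, (j <= n)%N -> 0 <= x ->
    half_derivn j w x = \sum_(i <- r) c i * half_derivn j (g i) x.
Proof.
move=> H w.
have D j x : (j < n)%N -> 0 <= x ->
    (forall t, 0 <= t ->
      half_derivn j w t = \sum_(i <- r) c i * half_derivn j (g i) t) ->
    is_chder (half_derivn j w) x (\sum_(i <- r) c i * half_derivn j.+1 (g i) x).
  move=> jn x0 E; apply: (@eq_is_chder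
    (fun t => \sum_(i <- r) c i * half_derivn j (g i) t)) => //.
    by move=> t t0; rewrite E.
  by apply: is_chder_comb => i; apply/half_derivableP/H.
have E j : (j <= n)%N -> forall x, 0 <= x ->
    half_derivn j w x = \sum_(i <- r) c i * half_derivn j (g i) x.
  elim: j => [//|j IH] jn x x0; rewrite {1}/half_derivn iterS.
  by have [] := is_chderP x0 (D j x jn x0 (IH (ltnW jn))).
split=> [j x jn x0|j x jn x0]; last exact: E.
by have [] := is_chderP x0 (D j x jn x0 (E j (ltnW jn))).
Qed.

(** Off x this is g t = g x + (difference quotient) (t - x). The filter of [is_hder] omits x itself,
    so t = x is added separately. *)
Lemma is_hder_cts g x l : 0 <= x -> is_hder g x l ->
  g t @[t --> within `[0, +oo[ (nbhs x)] --> g x.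
Proof.
move=> x0 H.
have : (g x + dquot g x t * (t - x)) @[t --> half_nbhs x] --> g x + l * (x - x).
  apply: cvgD; first exact: cvg_cst.
  apply: cvgM => //; apply: cvgB; last exact: cvg_cst.
  move=> A /= HA; apply/near_half_nbhs; apply: filterS HA => t At _ _; exact: At.
rewrite subrr mulr0 addr0 => /cvgrPdist_lt K.
apply/cvgrPdist_lt => e e0; move/near_half_nbhs: (K e e0) => {}K.
rewrite near_withinE; apply: filterS K => t Ht /=; rewrite in_itv /= andbT => t0.
have [->|tx] := eqVneq t x; first by rewrite subrr normr0.
have := Ht tx t0; rewrite /dquot divfK ?subr_eq0 //.
by congr (`| _ - _| < _); ring.
Qed.

Lemma is_hder_derive g x l : 0 < x -> is_hder g x l -> is_derive x 1 g l.
Proof.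
move=> x0 H.
have K : (fun h => h^-1 *: (g (h + x) - g x)) @ 0^' --> l.
  apply/cvgrPdist_lt => e e0; move/cvgrPdist_lt/(_ e e0)/near_half_nbhs : H.
  move=> -[d /= d0 Hd].
  (* A radius at most x keeps h + x inside the half-line, where the one-sided hypothesis applies. *)
  exists (Num.min d x); first by rewrite /= lt_min d0.
  move=> h /=; rewrite sub0r normrN lt_min => /andP[hd hx] h0.
  have := Hd (h + x); rewrite /dquot addrK => /(_ _ _ _); rewrite -[_ / h]mulrC.
  apply => /=.
  - by rewrite opprD addrCA subrr addr0 normrN.
  - by rewrite -subr_eq0 addrK.
  - have := ler_norm (- h); rewrite normrN; lra.
apply: DeriveDef.
  apply/cvg_ex; exists l => /=.
  apply: cvg_trans K; apply: near_eq_cvg; near=> h.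
  by rewrite [h *: 1]mulr1.
rewrite /derive; apply/cvg_lim; first exact: Rhausdorff.
apply: cvg_trans K; apply: near_eq_cvg; near=> h.
by rewrite [h *: 1]mulr1.
Unshelve. all: by end_near. Qed.

End HalfDerivatives.

(** * Real calculus *)

Section RealCalculus.
Context {R : realType}.
Implicit Types (x t : R) (g dg : R -> R).

Lemma within_cts_of_derive g dg a b :
  (forall x, a <= x <= b -> is_derive x 1 g (dg x)) -> {within `[a, b], continuous g}.
Proof.
move=> H; apply: derivable_within_continuous => x; rewrite in_itv /= => xab.
by have := H x xab => ?; exact: ex_derive.
Qed.

Lemma ge0_derive_homo g dg a : (forall x, a <= x -> is_derive x 1 g (dg x)) ->
  (forall x, a <= x -> 0 <= dg x) -> forall x t, a <= x -> x <= t -> g x <= g t.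
Proof.
move=> H H0 x t ax xt.
have ct : {within `[x, t], continuous g}.
  by apply: (@within_cts_of_derive _ dg) => s /andP[xs _]; apply: H; lra.
have dr s : s \in `]x, t[ -> is_derive s 1 g (dg s).
  by rewrite in_itv /= => /andP[xs _]; apply: H; lra.
have [c] := MVT_segment xt dr ct.
rewrite in_itv /= => /andP[xc _] E.
rewrite -subr_ge0 E mulr_ge0 ?subr_ge0 // H0 //; lra.
Qed.

Lemma bounded_derive_lipschitz g dg b t : 0 <= t ->
  (forall s, 0 <= s <= t -> is_derive s 1 g (dg s)) ->
  (forall s, 0 <= s <= t -> `|dg s| <= b) -> `|g t - g 0| <= b * t.
Proof.
move=> t0 H Hb.
have ct : {within `[0, t], continuous g} by apply: (@within_cts_of_derive _ dg).
have dr s : s \in `]0, t[ -> is_derive s 1 g (dg s).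
  by rewrite in_itv /= => /andP[xs xt]; apply: H; rewrite !ltW.
have [c] := MVT_segment t0 dr ct.
rewrite in_itv /= subr0 => xc ->.
by rewrite normrM (ger0_norm t0) ler_wpM2r // Hb.
Qed.

Lemma is_derive_sumf n (g : 'I_n -> R -> R) (dg : 'I_n -> R) x :
  (forall i, is_derive x 1 (g i) (dg i)) ->
  is_derive x 1 (fun t => \sum_i g i t) (\sum_i dg i).
Proof.
move=> H; rewrite (_ : (fun t => _) = \sum_i g i); first exact: is_derive_sum.
by apply/funext => t; rewrite fct_sumE.
Qed.

Lemma is_derive_addf g1 g2 d1 d2 x : is_derive x 1 g1 d1 -> is_derive x 1 g2 d2 ->
  is_derive x 1 (fun t => g1 t + g2 t : R) (d1 + d2).
Proof. exact: is_deriveD. Qed.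

Lemma is_derive_mulf g1 g2 d1 d2 x : is_derive x 1 g1 d1 -> is_derive x 1 g2 d2 ->
  is_derive x 1 (fun t => g1 t * g2 t : R) (d1 * g2 x + g1 x * d2).
Proof.
move=> H1 H2; apply: (is_derive_eq (is_deriveM H1 H2)).
by rewrite addrC /GRing.scale /= [g2 x * _]mulrC.
Qed.

Lemma is_derive_scalef (c : R) g d x : is_derive x 1 g d ->
  is_derive x 1 (fun t => c * g t) (c * d).
Proof. exact: is_deriveZ. Qed.

Lemma is_derive_compf (f g : R -> R) (a b x : R) : is_derive (g x) 1 f a ->
  is_derive x 1 g b -> is_derive x 1 (fun t => f (g t)) (a * b).
Proof. exact: is_derive1_comp. Qed.

Lemma is_derive_expRM (K x : R) :
  is_derive x 1 (fun t => expR (K * t)) (K * expR (K * x)).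
Proof.
apply: (is_derive_eq (is_derive_compf (is_derive_expR (K * x))
  (is_derive_scalef K (is_derive_id x 1)))).
by rewrite /= mulr1 mulrC.
Qed.

Lemma sqr_sum_le n (u : 'I_n -> R) :
  (\sum_i u i) ^+ 2 <= n%:R * \sum_i u i ^+ 2.
Proof.
rewrite expr2 mulr_suml.
(* Symmetrised as a double sum, the claim follows termwise from u_i u_j <= (u_i^2 + u_j^2) / 2. *)
have -> : n%:R * \sum_i u i ^+ 2 =
    \sum_(i < n) \sum_(j < n) (u i ^+ 2 + u j ^+ 2) / 2.
  apply/esym; under eq_bigr do rewrite -mulr_suml big_split /= sumr_const card_ord.
  rewrite -mulr_suml big_split /= sumr_const card_ord sumrMnl -mulr_natl; lra.
apply: ler_sum => i _; rewrite mulr_sumr; apply: ler_sum => j _.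
have := sqr_ge0 (u i - u j); nra.
Qed.

Lemma sum_sqr_le n (u : 'I_n -> R) : (forall i, 0 <= u i) ->
  \sum_i u i ^+ 2 <= (\sum_i u i) ^+ 2.
Proof.
move=> u0; rewrite [leRHS]expr2 mulr_suml; apply: ler_sum => i _.
rewrite expr2 ler_wpM2l // [leRHS](bigD1 i) //= lerDl.
exact: sumr_ge0.
Qed.

Lemma positive_lower_bound n (u : 'I_n -> R) : (forall i, 0 < u i) ->
  exists2 d : R, 0 < d & forall i, d <= u i.
Proof.
(* Each 1/u_i is at most T, so 1/T is a common lower bound; the summand 1 covers n = 0. *)
move=> u0; pose T := 1 + \sum_i (u i)^-1.
have T0 : 0 < T by rewrite ltr_pwDl // sumr_ge0 // => i _; rewrite invr_ge0 ltW.
exists T^-1 => [|i]; first by rewrite invr_gt0.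
rewrite -[leRHS]invrK lef_pV2 ?posrE ?invr_gt0 //.
rewrite /T (bigD1 i) //= addrCA lerDl addr_ge0 // sumr_ge0 // => j _.
by rewrite invr_ge0 ltW.
Qed.

Lemma expRN_small (e : R) : 0 < e -> exists2 X : R, 0 < X &
  forall x, X <= x -> expR (- x) <= e.
Proof.
move=> e0; exists (e^-1); first by rewrite invr_gt0.
move=> x Hx; rewrite expRN -(invrK e) lef_pV2 ?posrE ?expR_gt0 ?invr_gt0 //.
by apply: le_trans Hx _; have := expR_ge1Dx x; lra.
Qed.

End RealCalculus.

(** * Exponentially perturbed diagonal systems *)

Section PerturbedDiagonalSystem.
Context {R : realType}.
Local Notation Re := (@complex.Re R).
Local Notation Im := (@complex.Im R).

Implicit Types (x t : R) (y : R -> R[i]).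

Definition is_cderive (y : R -> R[i]) (x : R) (d : R[i]) :=
  is_derive x 1 (fun t => Re (y t)) (Re d) /\
  is_derive x 1 (fun t => Im (y t)) (Im d).

Lemma is_cderive_sqr_normc y x d : is_cderive y x d ->
  is_derive x 1 (fun t => normc (y t) ^+ 2) (2 * (Re (y x) * Re d + Im (y x) * Im d)).
Proof.
move=> [H1 H2].
rewrite (_ : (fun t => _) =
  fun t => Re (y t) * Re (y t) + Im (y t) * Im (y t)); last first.
  by apply/funext => t; rewrite sqr_normcE !expr2.
apply: (is_derive_eq (is_derive_addf (is_derive_mulf H1 H1) (is_derive_mulf H2 H2))).
ring.
Qed.

Lemma is_cderiveM y1 y2 x d1 d2 : is_cderive y1 x d1 -> is_cderive y2 x d2 ->
  is_cderive (fun t => y1 t * y2 t) x (d1 * y2 x + y1 x * d2).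
Proof.
move=> [H1 H2] [H3 H4]; split.
  rewrite (_ : (fun t => _) = fun t => Re (y1 t) * Re (y2 t) +
    (-1) * (Im (y1 t) * Im (y2 t))); last first.
    by apply/funext => t; rewrite Re_mul mulN1r.
  apply: (is_derive_eq (is_derive_addf (is_derive_mulf H1 H3)
    (is_derive_scalef (-1) (is_derive_mulf H2 H4)))).
  rewrite Re_add !Re_mul; ring.
rewrite (_ : (fun t => _) = fun t => Re (y1 t) * Im (y2 t) +
    Im (y1 t) * Re (y2 t)); last first.
  by apply/funext => t; rewrite Im_mul.
apply: (is_derive_eq (is_derive_addf (is_derive_mulf H1 H4) (is_derive_mulf H2 H3))).
rewrite Im_add !Im_mul; ring.
Qed.

Lemma is_cderive_cexpM (a : R[i]) (x : R) :
  is_cderive (fun t => cexp (a * t%:C)) x (a * cexp (a * x%:C)).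
Proof.
have EE t : cexp (a * t%:C) = (expR (Re a * t) * cos (Im a * t)) +i*
    (expR (Re a * t) * sin (Im a * t)).
  by rewrite /cexp Re_mul Im_mul /= !mulr0 subr0 add0r.
have D := is_derive_scalef (Im a) (is_derive_id x 1).
rewrite /is_cderive; split.
  under eq_fun do rewrite EE /=.
  apply: (is_derive_eq (is_derive_mulf (is_derive_expRM (Re a) x)
    (is_derive_compf (is_derive_cos _) D))).
  rewrite Re_mul EE /=; ring.
under eq_fun do rewrite EE /=.
apply: (is_derive_eq (is_derive_mulf (is_derive_expRM (Re a) x)
  (is_derive_compf (is_derive_sin _) D))).
rewrite Im_mul EE /=; ring.
Qed.

Lemma is_cderive_shift y x t d : is_cderive y (x + t) d ->
  is_cderive (fun s => y (x + s)) t d.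
Proof.
have A : is_derive t 1 (fun s => x + s) 1.
  exact: (is_derive_eq (is_derive_addf (is_derive_cst x t 1) (is_derive_id t 1))
    (add0r 1)).
move=> [H1 H2]; split.
  apply: (is_derive_eq (@is_derive_compf _ (fun t => Re (y t)) _ _ _ _ H1 A)).
  by rewrite mulr1.
apply: (is_derive_eq (@is_derive_compf _ (fun t => Im (y t)) _ _ _ _ H2 A)).
by rewrite mulr1.
Qed.

(** The mean value theorem fails for complex values; applying it to real and imaginary parts
    separately costs the factor 2. *)
Lemma is_cderive_lipschitz y dy (b t : R) : 0 <= t ->
  (forall s, 0 <= s <= t -> is_cderive y s (dy s)) ->
  (forall s, 0 <= s <= t -> normc (dy s) <= b) ->
  normc (y t - y 0) <= 2 * b * t.
Proof.
move=> t0 H Hb; apply: le_trans (ler_normc_ReIm _) _.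
rewrite Re_add Im_add Re_opp Im_opp mulrAC mulr2n mulrDl mul1r mulrDl mulrC.
apply: lerD.
  apply: (@bounded_derive_lipschitz _ (fun s => Re (y s)) (fun s => Re (dy s))) => // s st.
    by have [] := H s st.
  by apply: le_trans (ler_Re_normc _) _; exact: Hb.
apply: (@bounded_derive_lipschitz _ (fun s => Im (y s)) (fun s => Im (dy s))) => // s st.
  by have [] := H s st.
by apply: le_trans (ler_Im_normc _) _; exact: Hb.
Qed.

Variables (n : nat) (z r : 'I_n -> R -> R[i]) (a : 'I_n -> R[i]) (C : R).
Hypothesis C0 : 0 <= C.
Hypothesis zE : forall i x, 0 < x -> is_cderive (z i) x (a i * z i x + r i x).

(** Two sizes of the vector z: S suits the triangle inequalities of the sampling argument, N is
    differentiable and carries the growth estimates. [SN] and [NS] compare them. *)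
Let S x : R := \sum_i normc (z i x).
Let N x : R := \sum_i normc (z i x) ^+ 2.

Hypothesis r_le : forall i x, 0 < x -> normc (r i x) <= C * expR (- x) * S x.

Let S0 x : 0 <= S x. Proof. by apply: sumr_ge0 => i _; exact: normc_ge0. Qed.
Let N0 x : 0 <= N x. Proof. by apply: sumr_ge0 => i _; exact: sqr_ge0. Qed.
Let SN x : S x ^+ 2 <= n%:R * N x. Proof. exact: sqr_sum_le. Qed.
Let NS x : N x <= S x ^+ 2.
Proof. by apply: sum_sqr_le => i; exact: normc_ge0. Qed.

(** The real part of conj(z_i) r_i: the share of the perturbation in half the derivative of
    |z_i|^2. *)
Let cross i x := Re (z i x) * Re (r i x) + Im (z i x) * Im (r i x).

(** Im a_i drops out because Re (conj(z) a z) = Re a |z|^2. Weights 1 give the derivative of N,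
    weights of sign +1 or -1 that of the quadratic form. *)
Let is_derive_weighted (s : 'I_n -> R) x : 0 < x ->
  is_derive x 1 (fun t => \sum_i s i * normc (z i t) ^+ 2)
    (2 * (\sum_i s i * Re (a i) * normc (z i x) ^+ 2 + \sum_i s i * cross i x)).
Proof.
move=> x0; rewrite -big_split /= mulr_sumr.
apply: is_derive_sumf => i.
apply: (is_derive_eq (is_derive_scalef (s i) (is_cderive_sqr_normc (zE i x0)))).
rewrite sqr_normcE Re_add Im_add Re_mul Im_mul /cross; ring.
Qed.

Let cross_le (s : 'I_n -> R) x : 0 < x -> (forall i, `|s i| <= 1) ->
  `|\sum_i s i * cross i x| <= 2 * C * n%:R * expR (- x) * N x.
Proof.
move=> x0 s1; apply: le_trans (ler_norm_sum _ _ _) _.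
apply: (@le_trans _ _ (2 * C * expR (- x) * S x * S x)); last first.
  have -> : 2 * C * n%:R * expR (- x) * N x = 2 * C * expR (- x) * (n%:R * N x) by ring.
  by rewrite -[leLHS]mulrA -expr2 ler_wpM2l // !mulr_ge0 // expR_ge0.
rewrite mulr_sumr; apply: ler_sum => i _.
have Hc : `|cross i x| <= 2 * (normc (r i x) * normc (z i x)).
  rewrite /cross; apply: le_trans (ler_normD _ _) _; rewrite !normrM mulr2n mulrDl mul1r.
  by apply: lerD; rewrite mulrC ler_pM // ?ler_Re_normc ?ler_Im_normc.
rewrite normrM; apply: (@le_trans _ _ (`|cross i x|)); first by rewrite ler_piMl.
apply: le_trans Hc _.
have -> : 2 * C * expR (- x) * S x * normc (z i x) =
  2 * (C * expR (- x) * S x * normc (z i x)) by ring.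
by rewrite ler_wpM2l // ler_wpM2r ?normc_ge0 // r_le.
Qed.

(** A Gronwall constant for N: the diagonal part contributes 2 sum |a_i|, and twice the bound of
    [cross_le] with e^{-x} <= 1 contributes 4 C n. *)
Let growth_rate : R := 2 * \sum_i normc (a i) + 4 * C * n%:R.

Let growth_rate_ge0 : 0 <= growth_rate.
Proof.
by rewrite addr_ge0 // ?mulr_ge0 // sumr_ge0 // => i _; exact: normc_ge0.
Qed.

Let is_derive_N x : 0 < x ->
  exists2 d : R, is_derive x 1 N d & `|d| <= growth_rate * N x.
Proof.
move=> x0; exists (2 * (\sum_i 1 * Re (a i) * normc (z i x) ^+ 2 + \sum_i 1 * cross i x)).
  rewrite (_ : N = fun t => \sum_i 1 * normc (z i t) ^+ 2); last first.
    by apply/funext => t; apply: eq_bigr => i _; rewrite mul1r.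
  exact: is_derive_weighted.
rewrite normrM ger0_norm // /growth_rate.
have H1 : `|\sum_i 1 * cross i x| <= 2 * C * n%:R * expR (- x) * N x.
  by apply: cross_le => // i; rewrite normr1.
have H2 : 2 * C * n%:R * expR (- x) * N x <= 2 * C * n%:R * N x.
  rewrite ler_wpM2r // ler_piMr ?mulr_ge0 // -expR0 ler_expR; lra.
have H3 : `|\sum_i 1 * Re (a i) * normc (z i x) ^+ 2| <= (\sum_i normc (a i)) * N x.
  apply: le_trans (ler_norm_sum _ _ _) _; rewrite mulr_sumr.
  apply: ler_sum => i _; rewrite mul1r normrM (ger0_norm (sqr_ge0 _)).
  rewrite ler_wpM2r ?sqr_ge0 //; apply: le_trans (ler_Re_normc _) _.
  by rewrite (bigD1 i) //= lerDl sumr_ge0 // => j _; exact: normc_ge0.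
have := ler_normD (\sum_i 1 * Re (a i) * normc (z i x) ^+ 2) (\sum_i 1 * cross i x).
lra.
Qed.

(** Integrating factor for both Gronwall bounds: c = 1, K = [growth_rate] bounds N from below at
    later points, c = -1, K = -[growth_rate] from above. *)
Let N_homo (c K : R) x t : 0 < x -> x <= t ->
  (forall s d : R, x <= s -> `|d| <= growth_rate * N s -> 0 <= c * (K * N s + d)) ->
  c * (N x * expR (K * x)) <= c * (N t * expR (K * t)).
Proof.
move=> x0 xt H.
have D (s : R) : 0 < s -> {d : R | is_derive s 1 N d & `|d| <= growth_rate * N s}.
  by move=> s0; apply: cid2; exact: is_derive_N.
(* Choice turns the pointwise derivatives into a function; the default 0 at s <= 0 is never met,
   since s >= x > 0. *)
pose d (s : R) := if pselect (0 < s) is left s0 then s2val (D s s0) else 0.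
have dP (s : R) : x <= s -> is_derive s 1 N (d s) /\ `|d s| <= growth_rate * N s.
  move=> xs; rewrite /d; case: pselect => [s0|]; last by lra.
  by case: (D s s0).
apply: (@ge0_derive_homo _ (fun s => c * (N s * expR (K * s)))
  (fun s => c * (K * N s + d s) * expR (K * s)) x) => // s xs.
  have [H1 _] := dP s xs.
  apply: (is_derive_eq (is_derive_scalef c (is_derive_mulf H1 (is_derive_expRM K s)))).
  ring.
by have [_ H2] := dP s xs; rewrite mulr_ge0 ?expR_ge0 // H.
Qed.

Let N_growth x t : 0 < x -> x <= t ->
  N x <= N t * expR (growth_rate * (t - x)) /\
  N t <= N x * expR (growth_rate * (t - x)).
Proof.
move=> x0 xt; have gp s := expR_gt0 (growth_rate * s).
have E : expR (growth_rate * (t - x)) = expR (growth_rate * t) / expR (growth_rate * x).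
  by rewrite mulrBr expRD expRN.
split.
  have := @N_homo 1 growth_rate x t x0 xt.
  rewrite !mul1r E mulrA ler_pdivlMr //; apply => s d _.
  by rewrite mul1r ler_norml; lra.
have := @N_homo (-1) (- growth_rate) x t x0 xt.
rewrite !mulN1r lerN2 E mulrA ler_pdivlMr // !mulNr !expRN.
rewrite ler_pdivlMr // mulrAC ler_pdivrMr //; apply => s d _.
by rewrite mulN1r ler_norml; lra.
Qed.

(** Uniqueness for the system: the two-sided Gronwall bounds carry N = 0 both forward and
    backward. *)
Lemma vanishing_propagates x : 0 < x -> (forall i, z i x = 0) ->
  forall t i, 0 < t -> z i t = 0.
Proof.
move=> x0 zx0 t i t0.
have Nx : N x = 0 by apply: big1 => j _; rewrite zx0 normc0 expr0n.
suff : N t <= 0.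
  move=> Nt; have : N t == 0 by rewrite eq_le Nt N0.
  rewrite psumr_eq0 => [|j _]; last exact: sqr_ge0.
  by move=> /allP/(_ i)/(_ (mem_index_enum _)); rewrite sqrf_eq0 normc_eq0 => /eqP.
have [xt|/ltW tx] := leP x t.
  by have [_] := N_growth x0 xt; rewrite Nx mul0r.
by have [] := N_growth t0 tx; rewrite Nx mul0r.
Qed.

Let S_growth x t : 0 < x -> 0 <= t ->
  S (x + t) <= (1 + n%:R * expR (growth_rate * t)) * S x.
Proof.
(* The factor 1 + L replaces the square root of L: L <= (1 + L)^2. *)
move=> x0 t0; set L := n%:R * _; have L0 : 0 <= L by rewrite mulr_ge0 ?expR_ge0.
rewrite -(ler_pXn2r (n := 2)) ?nnegrE ?S0 ?mulr_ge0 ?S0 ?addr_ge0 //.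
apply: le_trans (SN _) _.
have xt : x <= x + t by rewrite lerDl.
have [_] := N_growth x0 xt; rewrite [x + t - x]addrC addKr => H.
apply: (@le_trans _ _ (L * S x ^+ 2)).
  rewrite /L mulrAC -mulrA ler_wpM2l // (le_trans H) // ler_wpM2r ?expR_ge0 //.
by rewrite exprMn ler_wpM2r ?sqr_ge0 //; nra.
Qed.

Let normc_cexp_le i (T t : R) : 0 <= t <= T ->
  normc (cexp (a i * t%:C)) <= expR ((\sum_j normc (a j)) * T) /\
  normc (cexp (- a i * t%:C)) <= expR ((\sum_j normc (a j)) * T).
Proof.
move=> /andP[t0 tT].
have : `|Re (a i)| * t <= (\sum_j normc (a j)) * T.
  apply: ler_pM => //; apply: le_trans (ler_Re_normc _) _.
  by rewrite (bigD1 i) //= lerDl sumr_ge0 // => j _; exact: normc_ge0.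
have := ler_norm (Re (a i)); have := ler_norm (- Re (a i)); rewrite normrN.
by rewrite !normc_cexp !ler_expR !Re_mul /= !mulr0 !subr0 !Re_opp; split; nra.
Qed.

(** Variation of constants on a window of length T: e^{-a s} z(x + s) has derivative e^{-a s} r(x +
    s), which is O(e^{-x} S x) because S grows at most by a fixed factor over the window. *)
Let sampling_error (T : R) : 0 <= T -> exists2 B : R, 0 <= B &
  forall i x t, 0 < x -> 0 <= t <= T ->
  normc (z i (x + t) - cexp (a i * t%:C) * z i x) <= B * expR (- x) * S x.
Proof.
move=> T0; set A := expR ((\sum_j normc (a j)) * T).
set L := 1 + n%:R * expR (growth_rate * T).
have L0 : 0 <= L by rewrite addr_ge0 // mulr_ge0 ?expR_ge0.
have A0 : 0 <= A by exact: expR_ge0.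
(* The outer A bounds e^{a t}, the inner one e^{-a s}; C L bounds the perturbation on the window,
   and 2 T comes from [is_cderive_lipschitz]. *)
exists (A * (2 * (A * (C * L)) * T)); first by rewrite !mulr_ge0.
move=> i x t x0 tT; have /andP[t0 tT'] := tT.
pose zeta s := cexp (- a i * s%:C) * z i (x + s).
have -> : z i (x + t) - cexp (a i * t%:C) * z i x =
    cexp (a i * t%:C) * (zeta t - zeta 0).
  rewrite /zeta mulrBr mulrA -cexpD -mulrDl subrr mul0r cexp0 mul1r.
  by rewrite rmorph0 mulr0 cexp0 mul1r addr0.
have D (s : R) : 0 <= s <= t ->
    is_cderive zeta s (cexp (- a i * s%:C) * r i (x + s)).
  move=> /andP[s0 st]; have xs : 0 < x + s by lra.
  have := is_cderiveM (is_cderive_cexpM (- a i) s) (is_cderive_shift (zE i xs)).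
  by congr (is_cderive _ _ _); ring.
have Db (s : R) : 0 <= s <= t ->
    normc (cexp (- a i * s%:C) * r i (x + s)) <= A * (C * L) * (expR (- x) * S x).
  move=> /andP[s0 st]; have sT : 0 <= s <= T by lra.
  rewrite normcM -mulrA; apply: ler_pM; rewrite ?normc_ge0 //.
    by have [] := normc_cexp_le i sT.
  have xs : 0 < x + s by lra.
  apply: le_trans (r_le i xs) _.
  rewrite -mulrA -[leRHS]mulrA ler_wpM2l // mulrCA.
  apply: ler_pM; rewrite ?expR_ge0 // ?ler_expR; first lra.
  apply: le_trans (S_growth x0 s0) _; rewrite ler_wpM2r // lerD2l ler_wpM2l //.
  by rewrite ler_expR ler_wpM2l //; lra.
have K := is_cderive_lipschitz t0 D Db.
rewrite normcM.
have -> : A * (2 * (A * (C * L)) * T) * expR (- x) * S x =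
  A * (2 * (A * (C * L) * (expR (- x) * S x)) * T) by ring.
apply: ler_pM; rewrite ?normc_ge0 //; first by have [] := normc_cexp_le i tT.
by apply: le_trans K _; rewrite ler_wpM2l // !mulr_ge0 // expR_ge0.
Qed.

Variables (y : R -> R[i]) (h : R).
Hypothesis yE : forall x, 0 < x -> y x = \sum_i z i x.
Hypothesis h0 : 0 < h.
Hypothesis h_inj : injective (fun i => cexp (a i * h%:C)).

(* The values of y at x + j h, j < n, are a Vandermonde image of z(x) up to an
   error O(e^{-x} |z(x)|), which is absorbed for large x. *)
Let observability : exists2 X : R, 0 < X & exists2 K : R, 0 <= K &
  forall x, X <= x -> S x <= K * \sum_(j < n) normc (y (x + j%:R * h)).
Proof.
have [K K0 HK] := invertible_coercive (Vandermonde_unit h_inj).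
have [|B B0 HB] := @sampling_error (n%:R * h); first by rewrite mulr_ge0 // ltW.
have KB0 : 0 <= K * n%:R * n%:R * B by rewrite !mulr_ge0.
(* One factor n counts the modes in a sample, the other the samples. Beyond X the total error is at
   most half of S x; absorbing it doubles K. *)
have [X X0 HX] := @expRN_small R (1 / (2 * (K * n%:R * n%:R * B + 1))) ltac:(
  by rewrite divr_gt0 //; lra).
exists X => //; exists (2 * K) => [|x Xx]; first by rewrite mulr_ge0.
have x0 : 0 < x by lra.
have Hj (j : 'I_n) : normc (\sum_i cexp (a i * h%:C) ^+ j * z i x) <=
    normc (y (x + j%:R * h)) + n%:R * (B * expR (- x) * S x).
  have jh : 0 <= j%:R * h <= n%:R * h.
    by rewrite mulr_ge0 ?(ltW h0) //= ler_wpM2r ?(ltW h0) // ler_nat ltnW.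
  rewrite yE; last by have /andP[] := jh; lra.
  have -> : \sum_i cexp (a i * h%:C) ^+ j * z i x = \sum_i z i (x + j%:R * h) +
      \sum_i - (z i (x + j%:R * h) - cexp (a i * (j%:R * h)%:C) * z i x).
    rewrite -big_split /=; apply: eq_bigr => i _.
    by rewrite opprB addrC subrK -cexpX rmorphM rmorph_nat mulrCA mulr_natl.
  apply: le_trans (normcD _ _) _; rewrite lerD2l.
  apply: le_trans (normc_sum _ _ _) _.
  apply: (@le_trans _ _ (\sum_(i < n) B * expR (- x) * S x)); last first.
    by rewrite sumr_const card_ord mulr_natl.
  by apply: ler_sum => i _; rewrite normc_opp HB.
have : S x <= K * (\sum_(j < n) normc (y (x + j%:R * h)) +
    n%:R * (n%:R * (B * expR (- x) * S x))).
  apply: le_trans (HK (fun i => z i x)) _; rewrite ler_wpM2l //.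
  apply: (@le_trans _ _ (\sum_(j < n) (normc (y (x + j%:R * h)) +
    n%:R * (B * expR (- x) * S x)))).
    by apply: ler_sum => j _; under eq_bigr do rewrite mxE; exact: Hj.
  by rewrite big_split /= sumr_const card_ord -[X in _ + X <= _]mulr_natl.
have : expR (- x) * (K * n%:R * n%:R * B) <= 1 / 2.
  have := HX x Xx; set M := K * _ * _ * _ in KB0 *; rewrite ler_pdivlMr; last first.
    by rewrite mulr_gt0 // ltr_wpDl.
  have := expR_ge0 (- x); nra.
move=> /(ler_wpM2r (S0 x)); lra.
Qed.

(* A form of square integrability on the half-line which is visibly stable under
   linear combinations and needs no integral: |y|^2 is dominated by the
   derivative of a function bounded above. *)
Definition square_tame (y : R -> R[i]) := exists F dF : R -> R, exists B : R,
  forall x, 0 < x ->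
    [/\ is_derive x 1 F (dF x), normc (y x) ^+ 2 <= dF x & F x <= B].

Variables (s : 'I_n -> R) (delta : R).
Hypothesis s_le1 : forall i, `|s i| <= 1.
Hypothesis s_delta : forall i, delta <= s i * Re (a i).

(* The quadratic form is nondecreasing once the perturbation is below the
   spectral gap delta, so a positive value would keep |z| bounded below and, by
   observability, the primitive in [square_tame] unbounded. *)
Lemma tame_cone x : 0 < x -> 2 * C * n%:R * expR (- x) <= delta ->
  square_tame y -> \sum_i s i * normc (z i x) ^+ 2 <= 0.
Proof.
move=> x0 xdelta [F [dF [B HF]]]; rewrite leNgt; apply/negP => Q0.
set Q := fun t : R => \sum_i s i * normc (z i t) ^+ 2.
have QN t : Q t <= N t.
  apply: ler_sum => i _; rewrite ler_piMl ?sqr_ge0 //.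
  by apply: le_trans (ler_norm _) _.
have Qhomo t : x <= t -> Q x <= Q t.
  apply: (@ge0_derive_homo _ Q _ x (fun t xt =>
    is_derive_weighted s (lt_le_trans x0 xt))) => // t' xt'.
  have t'0 : 0 < t' by lra.
  have H1 := cross_le t'0 s_le1.
  have H2 : delta * N t' <= \sum_i s i * Re (a i) * normc (z i t') ^+ 2.
    by rewrite mulr_sumr; apply: ler_sum => i _; rewrite ler_wpM2r ?sqr_ge0.
  have H3 : 2 * C * n%:R * expR (- t') * N t' <= delta * N t'.
    rewrite ler_wpM2r // (le_trans _ xdelta) // ler_wpM2l ?mulr_ge0 // ler_expR; lra.
  have := ler_norm (- \sum_i s i * cross i t'); rewrite normrN; lra.
have [X X0 [K K0 HK]] := observability.
pose Y t : R := \sum_(j < n) normc (y (t + j%:R * h)) ^+ 2.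
have YQ t : x <= t -> X <= t -> Q x <= K ^+ 2 * n%:R * Y t.
  move=> xt Xt; apply: le_trans (Qhomo t xt) _.
  apply: le_trans (QN t) _; apply: le_trans (NS t) _.
  apply: (@le_trans _ _ ((K * \sum_(j < n) normc (y (t + j%:R * h))) ^+ 2)).
    rewrite ler_pXn2r ?nnegrE ?S0 ?HK //.
    by rewrite mulr_ge0 // sumr_ge0 // => j _; exact: normc_ge0.
  by rewrite exprMn -mulrA ler_wpM2l ?sqr_ge0 // sqr_sum_le.
pose Kn := K ^+ 2 * n%:R.
(* Nothing so far excludes K = 0 or n = 0; but Kn = 0 in [YQ] would give Q x <= 0. *)
have Kn0 : 0 < Kn.
  rewrite lt_def mulr_ge0 ?sqr_ge0 // andbT; apply: contraTneq Q0 => E.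
  rewrite -leNgt; have := YQ (x + X); rewrite -/Kn E mul0r; apply; lra.
(* The derivative of this sum of shifted primitives is at least Y, hence at least q > 0 beyond x1,
   while G is at most n B. *)
pose G t : R := \sum_(j < n) F (t + j%:R * h).
have GB t : 0 < t -> G t <= n%:R * B.
  move=> t0; rewrite mulr_natl -[n in _ *+ n]card_ord -sumr_const.
  apply: ler_sum => j _.
  have tj : 0 < t + j%:R * h by rewrite ltr_pwDl // mulr_ge0 // ltW.
  by have [] := HF _ tj.
set q := Q x / Kn; have q0 : 0 < q by rewrite divr_gt0.
pose x1 := x + X; have x10 : 0 < x1 by rewrite addr_gt0.
have Ghomo t : x1 <= t -> G x1 - q * x1 <= G t - q * t.
  pose dG t : R := \sum_(j < n) dF (t + j%:R * h).
  apply: (@ge0_derive_homo _ (fun t => G t - q * t) (fun t => dG t - q) x1) => // u xu.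
    have -> : (fun t => G t - q * t) = fun t => G t + (- q) * t.
      by apply/funext => v; rewrite mulNr.
    apply: is_derive_addf; last first.
      by apply: (is_derive_eq (is_derive_scalef (- q) (is_derive_id u 1))); rewrite mulr1.
    apply: is_derive_sumf => j.
    have uj : 0 < u + j%:R * h.
      by rewrite ltr_pwDl ?mulr_ge0 ?(ltW h0) // (lt_le_trans x10).
    have [D _ _] := HF _ uj.
    have A : is_derive u 1 (fun v : R => v + j%:R * h) 1.
      exact: (is_derive_eq (is_derive_addf (is_derive_id u 1)
        (is_derive_cst (j%:R * h) u 1)) (addr0 1)).
    by apply: (is_derive_eq (@is_derive_compf _ F (fun v => v + j%:R * h) _ _ u D A));
      rewrite mulr1.
  rewrite subr_ge0 /q ler_pdivrMr //.
  have xu' : x <= u by rewrite /x1 in xu; lra.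
  have Xu : X <= u by rewrite /x1 in xu; lra.
  apply: le_trans (YQ u xu' Xu) _; rewrite mulrC ler_wpM2r ?(ltW Kn0) //.
  apply: ler_sum => j _.
  have uj : 0 < u + j%:R * h by rewrite ltr_pwDl ?mulr_ge0 ?(ltW h0) // (lt_le_trans x10).
  by have [] := HF _ uj.
(* At this t, growth at rate q takes G to at least n B + 1. *)
pose t := x1 + (n%:R * B - G x1 + 1) / q.
have num0 : 0 < n%:R * B - G x1 + 1 by have := GB x1 x10; lra.
have x1t : x1 <= t by rewrite lerDl divr_ge0 // ltW.
have := Ghomo t x1t; have t0 : 0 < t by lra.
have -> : q * t = q * x1 + (n%:R * B - G x1 + 1).
  by rewrite mulrDr [q * (_ / _)]mulrC divfK ?gt_eqF.
have := GB t t0; lra.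
Qed.

End PerturbedDiagonalSystem.

(** * Series and special solutions *)

Section SeriesBounds.
Context {R : realType}.
Implicit Types (u : nat -> R[i]) (f w : nat -> R).
Local Notation Re := (@complex.Re R).
Local Notation Im := (@complex.Im R).

(** For w >= 0 this is summability, kept in the reals so that comparison and addition stay
    elementary. *)
Definition bounded_sums w := exists2 W : R, 0 <= W &
  forall N : nat, \sum_(1 <= n < N) w n <= W.

Lemma bounded_sums_lty w : (forall n, 0 <= w n) ->
  (\sum_(1 <= n <oo) (w n)%:E < +oo)%E -> bounded_sums w.
Proof.
move=> w0 H.
have H0 : (0 <= \sum_(1 <= n <oo) (w n)%:E)%E.
  by apply: nneseries_ge0 => n _ _; rewrite lee_fin.
have fn : (\sum_(1 <= n <oo) (w n)%:E)%E \is a fin_num by rewrite ge0_fin_numE.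
exists (fine (\sum_(1 <= n <oo) (w n)%:E)%E); first exact: fine_ge0.
move=> N; rewrite -lee_fin fineK // -sumEFin.
by apply: nneseries_lim_ge => n _ _; rewrite lee_fin.
Qed.

Lemma le_bounded_sums w1 w2 : (forall n, (1 <= n)%N -> w1 n <= w2 n) ->
  bounded_sums w2 -> bounded_sums w1.
Proof.
move=> H [W W0 HW]; exists W => // N; apply: le_trans (HW N).
by rewrite big_nat [leRHS]big_nat; apply: ler_sum => n /andP[+ _]; exact: H.
Qed.

Lemma bounded_sumsD w1 w2 : bounded_sums w1 -> bounded_sums w2 ->
  bounded_sums (fun n => w1 n + w2 n).
Proof.
move=> [W1 W10 HW1] [W2 W20 HW2]; exists (W1 + W2); first exact: addr_ge0.
by move=> N; rewrite big_split /= lerD.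
Qed.

Lemma real_series_bound f (W : R) :
  (forall N : nat, \sum_(1 <= n < N) `|f n| <= W) ->
  `|\big[+%R/0]_(1 <= n <oo) f n| <= W.
Proof.
(* [series] starts at 0 and the sum at 1: the term of index 0 is replaced by 0. *)
move=> HW; pose f' n : R := if n == 0%N then 0 else f n.
have E (g : nat -> R) N : \sum_(1 <= n < N) g n =
    series (fun n => if n == 0%N then 0 else g n) N.
  case: N => [|N]; rewrite /series /=; first by rewrite !big_geq.
  rewrite [RHS]big_ltn //= add0r big_nat [RHS]big_nat.
  by apply: eq_bigr => -[].
have En N : [normed series f'] N = \sum_(1 <= n < N) `|f n|.
  rewrite E /series /=; apply: eq_bigr => n _.
  by rewrite /f'; case: eqP => // _; rewrite normr0.
have C : cvgn [normed series f'].
  apply: nondecreasing_is_cvgn.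
    by apply: nondecreasing_series => n _ _; exact: normr_ge0.
  by exists W => _ [N _ <-]; rewrite En.
rewrite (_ : (fun N => _) = series f'); last by apply/funext => N; rewrite E.
apply: le_trans (lim_series_norm C) _.
by apply: limr_le => //; apply: nearW => N; rewrite En.
Qed.

(** K is fixed before u and b, so a single constant serves every x, with b carrying the dependence
    on x. *)
Lemma cseries_bound w : bounded_sums w -> exists2 K : R, 0 <= K &
  forall u (b : R), 0 <= b -> (forall n, (1 <= n)%N -> normc (u n) <= b * w n) ->
    normc (cseries u) <= b * K.
Proof.
move=> [W W0 HW]; exists (2 * W); first by rewrite mulr_ge0.
move=> u b b0 Hu; apply: le_trans (ler_normc_ReIm _) _ => /=.
have H (g : R[i] -> R) : (forall z, `|g z| <= normc z) ->
    `|\big[+%R/0]_(1 <= n <oo) g (u n)| <= b * W.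
  move=> gle; apply: real_series_bound => N.
  apply: (@le_trans _ _ (b * \sum_(1 <= n < N) w n)); last by rewrite ler_wpM2l.
  rewrite mulr_sumr big_nat [leRHS]big_nat; apply: ler_sum => n /andP[n1 _].
  by apply: le_trans (gle _) _; exact: Hu.
have := H _ (@ler_Re_normc R); have := H _ (@ler_Im_normc R); lra.
Qed.

Lemma sum_lty_term (I : eqType) (r : seq I) (F : I -> \bar R) i : i \in r ->
  (forall j, (0 <= F j)%E) -> (\sum_(j <- r) F j < +oo)%E -> (F i < +oo)%E.
Proof.
move=> ir F0; apply: le_lt_trans.
by rewrite (big_rem i) //= leeDl // sume_ge0.
Qed.

End SeriesBounds.

(** * Decay of the coefficients p_gamma and asymptotics of the decaying special solutions *)

Section CoefficientBounds.
Context {R : realType}.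
Variable m : nat.
Hypothesis m1 : (1 <= m)%N.
Local Notation Re := (@complex.Re R).
Local Notation Im := (@complex.Im R).

(** The exponential series has no constant term: n >= 1 gives e^{-nx} <= e^{-x} for x >= 0. The
    weights n^(gamma + s) are at least 1, so the coefficients are themselves summable. *)
Lemma pcoef_bound (p : nat -> nat -> nat -> R[i]) (k : R[i]) : p_summable m p ->
  exists2 K : R, 0 <= K & forall (gamma : 'I_(2 * m).-1) (x : R), 0 <= x ->
    normc (pcoef m p gamma x k) <= K * expR (- x).
Proof.
move=> hp.
have B (gamma : 'I_(2 * m).-1) (s : 'I_(2 * m - gamma)) :
    bounded_sums (fun n => normc (p gamma s n)).
  have t0 g s' n : 0 <= n%:R ^+ (g + s') * normc (p g s' n) :> R.
    by rewrite mulr_ge0 ?exprn_ge0 ?normc_ge0.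
  apply: (@le_bounded_sums _ _ (fun n => n%:R ^+ (gamma + s) * normc (p gamma s n))).
    by move=> n n1; rewrite ler_peMl ?normc_ge0 // exprn_ege1 // ler1n.
  apply: bounded_sums_lty => [n|]; first exact: t0.
  have s0 g s' : (0 <= \sum_(1 <= n <oo) (n%:R ^+ (g + s') * normc (p g s' n))%:E)%E.
    by apply: nneseries_ge0 => n _ _; rewrite lee_fin t0.
  move: hp => /(sum_lty_term (mem_index_enum gamma)) H.
  have {}H := H (fun g => ltac:(by apply: sume_ge0 => s' _; exact: s0)).
  exact: (sum_lty_term (mem_index_enum s) (fun s' => s0 _ s') H).
have H (gamma : 'I_(2 * m).-1) : exists2 K : R, 0 <= K &
    forall x, 0 <= x -> normc (pcoef m p gamma x k) <= K * expR (- x).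
  have /fin_all_exists2[K K0 HK] := fun s => cseries_bound (B gamma s).
  exists (\sum_(s < 2 * m - gamma) normc k ^+ s * K s).
    by apply: sumr_ge0 => s _; rewrite mulr_ge0 ?exprn_ge0 ?normc_ge0.
  move=> x x0; apply: le_trans (normc_sum _ _ _) _; rewrite mulr_suml.
  apply: ler_sum => s _; rewrite mulrAC; apply: HK.
    by rewrite mulr_ge0 ?exprn_ge0 ?normc_ge0 ?expR_ge0.
  move=> n n1; rewrite !normcM normcX normc_cexp -mulrA mulrC ler_wpM2r ?normc_ge0 //.
  rewrite ler_wpM2l ?exprn_ge0 ?normc_ge0 // ler_expR Re_opp lerN2 /=.
  by rewrite ler_peMl // ler1n.
have [K K0 HK] := fin_all_exists2 H.
exists (\sum_gamma K gamma) => [|gamma x x0]; first exact: sumr_ge0.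
apply: le_trans (HK _ _ x0) _; rewrite ler_wpM2r ?expR_ge0 //.
by rewrite (bigD1 gamma) //= lerDl sumr_ge0.
Qed.

Lemma omegaE j : omega m j = cos (j%:R * pi / m%:R) +i* sin (j%:R * pi / m%:R) :> R[i].
Proof.
rewrite /omega /cexp Re_mul Im_mul /=.
by rewrite !(mul0r, mulr0, mul1r, add0r, addr0, subr0, oppr0, expR0).
Qed.

Lemma cos_omega_lt1 j : (1 <= j < 2 * m)%N -> cos (j%:R * pi / m%:R) < 1 :> R.
Proof.
move=> /andP[j1 j2]; apply: cos_lt1.
have m0 : 0 < m%:R :> R by rewrite ltr0n.
have j0 : 0 < j%:R :> R by rewrite ltr0n.
have p0 := pi_gt0 R.
rewrite gtr0_norm ?divr_gt0 ?mulr_gt0 //= ltr_pdivrMr // mulrAC ltr_pM2r //.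
by rewrite -natrM ltr_nat.
Qed.

(* The poles of f_tau all satisfy Im (k omega_tau) = -n/2 < 0. *)
Lemma denominator_neq0 (kappa : R[i]) n j : 0 < Im kappa -> (1 <= n)%N ->
  (1 <= j < 2 * m)%N -> 'i * n%:R + kappa * (1 - omega m j) != 0.
Proof.
move=> v0 n1 /cos_omega_lt1; rewrite omegaE.
have := cos2Dsin2 (j%:R * pi / m%:R : R).
move: (cos _) (sin _) => c s cs c1; apply/negP => /eqP E.
have n0 : 0 < n%:R :> R by rewrite ltr0n.
have Rn : Re (n%:R) = n%:R :> R by rewrite -(rmorph_nat (real_complex R)).
have In : Im (n%:R) = 0 :> R by rewrite -(rmorph_nat (real_complex R)).
have := congr1 Re E; have := congr1 Im E.
rewrite !Re_add !Im_add !Re_mul !Im_mul !Re_add !Im_add !Re_opp !Im_opp /= Rn In.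
move: (Re kappa) (Im kappa) v0 => u v v0 E1 E2.
(* The imaginary part of the equation times the conjugate of 1 - omega_j: n (1 - c) + v |1 -
   omega_j|^2, whose first term is positive and second nonnegative. *)
have : n%:R * (1 - c) + v * (1 - c) ^+ 2 + v * s ^+ 2 = 0.
  transitivity ((1 - c) * (n%:R + v * (1 - c) - u * s) + s * (u * (1 - c) + v * s)); first ring.
  have -> : n%:R + v * (1 - c) - u * s = 0 by lra.
  have -> : u * (1 - c) + v * s = 0 by lra.
  by rewrite !mulr0 addr0.
have : 0 < n%:R * (1 - c) by rewrite mulr_gt0 // subr_gt0.
have : 0 <= v * (1 - c) ^+ 2 by rewrite mulr_ge0 ?sqr_ge0 // ltW.
have : 0 <= v * s ^+ 2 by rewrite mulr_ge0 ?sqr_ge0 // ltW.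
lra.
Qed.

Lemma knjt_neq (k : R[i]) n j tau : 0 < Im (k * omega m tau) -> (1 <= n)%N ->
  (1 <= j < 2 * m)%N -> k != knjt m n j tau.
Proof.
move=> v0 n1 jm; apply: contraTneq (denominator_neq0 v0 n1 jm) => ->.
have o0 : omega m tau * (1 - omega m j) != 0 :> R[i].
  rewrite mulf_neq0 ?cexp_neq0 // subr_eq0.
  have := cos_omega_lt1 jm; rewrite omegaE; apply: contraTneq => /(congr1 Re) /= <-.
  by rewrite ltxx.
by rewrite negbK /knjt -mulrA mulNr divfK // subrr.
Qed.

(** For n >= |w| + 1 the denominator has modulus at least 1; the finitely many smaller n, where it
    is nonzero, enter D through their inverses. *)
Lemma denominator_bound (kappa : R[i]) j : 0 < Im kappa -> (1 <= j < 2 * m)%N ->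
  exists2 D : R, 0 <= D & forall n, (1 <= n)%N ->
    normc ('i * n%:R + kappa * (1 - omega m j))^-1 <= D.
Proof.
move=> v0 jm; set w := kappa * _.
have [N HN] : exists N : nat, normc w + 1 <= N%:R.
  by exists (Num.truncn (normc w + 1)).+1; rewrite ltW // truncnS_gt.
have inv0 n : 0 <= normc ('i * n%:R + w)^-1 by exact: normc_ge0.
exists (1 + \sum_(n < N) normc ('i * n%:R + w)^-1).
  by rewrite addr_ge0 // sumr_ge0.
move=> n n1; have [nN|Nn] := ltnP n N.
  by rewrite (bigD1 (Ordinal nN)) //= addrCA lerDl addr_ge0 // sumr_ge0.
rewrite ler_wpDr ?sumr_ge0 // normcV invf_le1.
  have := normcD ('i * n%:R + w) (- w); rewrite addrK normc_opp normcM.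
  rewrite -(rmorph_nat (real_complex R)) normc_real normr_nat.
  rewrite /= expr0n expr1n add0r sqrtr1 mul1r.
  have : N%:R <= n%:R :> R by rewrite ler_nat.
  lra.
by rewrite lt_def normc_ge0 andbT normc_eq0 denominator_neq0.
Qed.

Section SpecialSolution.
Variables (V : nat -> nat -> R[i]) (U : nat -> nat -> nat -> nat -> R[i]).
Variable tau : nat.
Hypothesis VU : coef_summable m V U tau.

Lemma bounded_sums_V : bounded_sums (fun alpha => normc (V tau alpha)).
Proof.
case: VU => _ _ H.
have t0 n : 0 <= n%:R ^+ (2 * m) * normc (V tau n) :> R.
  by rewrite mulr_ge0 ?exprn_ge0 ?normc_ge0.
apply: le_bounded_sums (bounded_sums_lty t0 H) => n n1.
by rewrite ler_peMl ?normc_ge0 // exprn_ege1 // ler1n.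
Qed.

(** The weight alpha - n vanishes on the diagonal, which is therefore taken from the second series.
    For n < alpha the weight alpha^(2m-1) (alpha - n) / n is at least alpha / n >= 1. *)
Lemma bounded_sums_U j : (1 <= j < 2 * m)%N ->
  bounded_sums (fun alpha => \sum_(1 <= n < alpha.+1) normc (U j tau n alpha)).
Proof.
move=> jm; have jr : j \in index_iota 1 (2 * m) by rewrite mem_index_iota.
case: VU => H1 H2 _.
pose G n alpha : R := alpha%:R ^+ (2 * m).-1 * (alpha - n)%:R * normc (U j tau n alpha).
have G0 i n alpha : 0 <= alpha%:R ^+ (2 * m).-1 * (alpha - n)%:R *
    normc (U i tau n alpha) :> R.
  by rewrite !mulr_ge0 ?exprn_ge0 ?normc_ge0.
have d0 i n : 0 <= n%:R ^+ (2 * m).-1 * normc (U i tau n n) :> R.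
  by rewrite !mulr_ge0 ?exprn_ge0 ?normc_ge0.
have diag : bounded_sums (fun n => normc (U j tau n n)).
  have /(bounded_sums_lty (d0 j)) := sum_lty_term jr (fun i => nneseries_ge0
    (fun n _ _ => d0 i n : (0 <= (_ : R)%:E)%E)) H2.
  apply: le_bounded_sums => n n1.
  by rewrite ler_peMl ?normc_ge0 // exprn_ege1 // ler1n.
have T0 i n : (0 <= (n%:R^-1)%:E * \sum_(n <= alpha <oo)
   (alpha%:R ^+ (2 * m).-1 * (alpha - n)%:R * normc (U i tau n alpha))%:E)%E.
  rewrite mule_ge0 ?lee_fin ?invr_ge0 //.
  by apply: nneseries_ge0 => alpha _ _; rewrite lee_fin G0.
have off : bounded_sums (fun alpha => \sum_(1 <= n < alpha) normc (U j tau n alpha)).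
  have L := sum_lty_term jr (fun i => nneseries_ge0 (fun n _ _ => T0 i n)) H1.
  set T := (\sum_(1 <= n <oo) _)%E in L.
  have Tge0 : (0 <= T)%E by apply: nneseries_ge0 => n _ _; exact: T0.
  have Tfin : T \is a fin_num by rewrite ge0_fin_numE.
  exists (fine T); first exact: fine_ge0.
  move=> A.
  (* The order of summation is exchanged on a finite triangle, before the truncated sums are
     compared with the infinite ones. *)
  apply: (@le_trans _ _ (\sum_(1 <= n < A) n%:R^-1 * \sum_(n <= alpha < A) G n alpha)).
    rewrite big_nat; under eq_bigr => alpha /andP[_ /ltnW aA] do
      rewrite (big_nat_widen _ _ _ _ _ aA).
    rewrite -big_nat (exchange_big_dep_nat xpredT) //=.
    rewrite big_nat [leRHS]big_nat; apply: ler_sum => n /andP[n1 nA].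
    rewrite -(big_nat_widenl n.+1 1 A xpredT) //.
    rewrite [X in _ * X]big_ltn // /G subnn mulr0 mul0r add0r mulr_sumr.
    rewrite big_nat [leRHS]big_nat; apply: ler_sum => alpha /andP[na _].
    have n0 : 0 < n%:R :> R by rewrite ltr0n.
    have a1 : (0 < alpha)%N by apply: leq_trans na.
    rewrite mulrA ler_peMl ?normc_ge0 // mulrC ler_pdivlMr // mul1r.
    apply: (@le_trans _ _ (alpha%:R * 1)); first by rewrite mulr1 ler_nat ltnW.
    apply: ler_pM => //; last by rewrite ler1n subn_gt0.
    have [q ->] : exists q, (2 * m).-1 = q.+1
      by exists (2 * m.-1)%N; rewrite -{1}(prednK m1) mulnS.
    by rewrite exprS ler_peMr // exprn_ege1 // ler1n.
  rewrite -lee_fin fineK // -sumEFin.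
  apply: (@le_trans _ _ (\sum_(1 <= n < A) ((n%:R^-1)%:E * \sum_(n <= alpha <oo)
      (G n alpha)%:E))%E); last by apply: nneseries_lim_ge => n _ _; exact: T0.
  apply: lee_sum => n _; rewrite EFinM lee_wpmul2l ?lee_fin ?invr_ge0 // -sumEFin.
  by apply: nneseries_lim_ge => alpha _ _; rewrite lee_fin G0.
apply: le_bounded_sums (bounded_sumsD off diag) => alpha a1.
by rewrite big_nat_recr.
Qed.

(** Every correction has alpha >= 1, so e^{(Re a - 1) x} factors out uniformly; the inverse
    denominators are bounded because Im (k omega_tau) > 0. *)
Lemma fsol_asymp (k : R[i]) : 0 < Im (k * omega m tau) ->
  exists2 K : R, 0 <= K & forall x : R, 0 <= x ->
    normc (fsol m V U tau k x - cexp ('i * k * omega m tau * x%:C)) <=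
      K * expR ((Re ('i * k * omega m tau) - 1) * x).
Proof.
move=> v0.
have Ele alpha (x : R) : (1 <= alpha)%N -> 0 <= x ->
   normc (cexp ((- alpha%:R + 'i * k * omega m tau) * x%:C)) <=
     expR ((Re ('i * k * omega m tau) - 1) * x).
  move=> a1 x0; rewrite normc_cexp ler_expR Re_mul /= mulr0 subr0 ler_wpM2r //.
  rewrite Re_add addrC lerD2l Re_opp lerN2 -(rmorph_nat (real_complex R)) /=.
  by rewrite ler1n.
have [KV KV0 HV] := cseries_bound bounded_sums_V.
have HU (j : 'I_(2 * m).-1) : exists2 K : R, 0 <= K & forall x, 0 <= x ->
   normc (cseries (fun alpha => \sum_(1 <= n < alpha.+1)
      U j.+1 tau n alpha / ('i * n%:R + k * omega m tau * (1 - omega m j.+1))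
      * cexp ((- alpha%:R + 'i * k * omega m tau) * x%:C)))
   <= K * expR ((Re ('i * k * omega m tau) - 1) * x).
  have jm : (1 <= j.+1 < 2 * m)%N by have := ltn_ord j; rewrite ltn_predRL.
  have [D D0 HD] := denominator_bound v0 jm.
  have [K K0 HK] := cseries_bound (bounded_sums_U jm).
  exists (D * K) => [|x x0]; first exact: mulr_ge0.
  rewrite [leRHS]mulrAC; apply: HK => [|alpha a1]; first by rewrite mulr_ge0 ?expR_ge0.
  apply: le_trans (normc_sum _ _ _) _; rewrite mulr_sumr big_nat [leRHS]big_nat.
  apply: ler_sum => n /andP[n1 _].
  rewrite !normcM -mulrA [leRHS]mulrC ler_wpM2l ?normc_ge0 //.
  by apply: ler_pM; rewrite ?normc_ge0 ?HD ?Ele.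
have [KU KU0 HKU] := fin_all_exists2 HU.
exists (KV + \sum_j KU j) => [|x x0]; first by rewrite addr_ge0 ?sumr_ge0.
rewrite /fsol /= addrAC [X in X + _]addrAC subrr add0r mulrDl.
apply: le_trans (normcD _ _) _; apply: lerD.
  rewrite [leRHS]mulrC; apply: HV => [|alpha a1]; first exact: expR_ge0.
  by rewrite normcM mulrC ler_wpM2r ?normc_ge0 // Ele.
apply: le_trans (normc_sum _ _ _) _.
rewrite big_add1 big_mkord mulr_suml; apply: ler_sum => j _; exact: HKU.
Qed.

End SpecialSolution.

End CoefficientBounds.

(** * Modal coordinates of the solutions *)

Section StableSolutions.
Context {R : realType}.
Variable m : nat.
Hypothesis m1 : (1 <= m)%N.
Variable k : R[i].
Hypothesis k0 : k != 0.
Local Notation Re := (@complex.Re R).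
Local Notation Im := (@complex.Im R).
Implicit Types (w : R -> R[i]) (x : R) (i j : 'I_(2 * m)).

Definition exponent (tau : nat) : R[i] := 'i * k * omega m tau.

Let m0 : 0 < m%:R :> R. Proof. by rewrite ltr0n. Qed.

Lemma omega_pow tau : omega m tau ^+ (2 * m) = 1 :> R[i].
Proof.
rewrite /omega -cexpX.
have -> : 'i * (tau%:R * pi / m%:R)%:C *+ (2 * m) = ('i * (pi *+ 2)%:C) *+ tau :> R[i].
  rewrite -[LHS]mulr_natr -[RHS]mulr_natr -[LHS]mulrA -[RHS]mulrA; congr (_ * _).
  rewrite -!(rmorph_nat (real_complex R)) -!rmorphM; congr (_%:C).
  by rewrite natrM mulr2n; field; rewrite gt_eqF.
rewrite cexpX (_ : cexp _ = 1) ?expr1n //.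
apply: complexP; rewrite /cexp Re_mul Im_mul /=;
  by rewrite !(mul0r, mulr0, mul1r, add0r, addr0, subr0, oppr0, expR0) ?cos2pi ?sin2pi.
Qed.

(** Hence e^{a x} solves the unperturbed equation (-1)^m y^(2m) = k^(2m) y, and the leading part of
    the system is diagonal in modal coordinates. *)
Lemma exponent_pow tau : exponent tau ^+ (2 * m) = (-1) ^+ m * k ^+ (2 * m).
Proof. by rewrite /exponent !exprMn omega_pow mulr1 exprM sqr_i. Qed.

Lemma omega_inj tau sigma : (tau < 2 * m)%N -> (sigma < 2 * m)%N ->
  omega m tau = omega m sigma :> R[i] -> tau = sigma.
Proof.
move=> t2 s2 /cexp_inj; rewrite -mulrBr -rmorphB Im_mul /= mul0r mul1r add0r.
have p0 := pi_gt0 R.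
rewrite -!mulrA -mulrBl !mulrA normrM normfV (gtr0_norm m0) normrM (gtr0_norm p0).
have : `|tau%:R - sigma%:R| < 2 * m%:R :> R.
  have tR : tau%:R < 2 * m%:R :> R by rewrite -natrM ltr_nat.
  have sR : sigma%:R < 2 * m%:R :> R by rewrite -natrM ltr_nat.
  have := ler0n R tau; have := ler0n R sigma; rewrite ltr_norml; lra.
move=> H.
have -> : `|tau%:R - sigma%:R| * pi / m%:R < 2 * pi :> R.
  by rewrite ltr_pdivrMr // mulrAC ltr_pM2r.
have i0 : 'i != 0 :> R[i] by rewrite eq_complex /= oner_eq0 andbF.
move=> /(_ isT) /(mulfI i0) /complexI E1.
apply/eqP; rewrite -(eqr_nat R); apply/eqP.
by apply: (mulIf (lt0r_neq0 p0)); apply: (mulIf (invr_neq0 (lt0r_neq0 m0))).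
Qed.

Lemma exponent_inj : injective (fun i => exponent i).
Proof.
have ik0 : 'i * k != 0 :> R[i].
  by rewrite mulf_neq0 // eq_complex /= oner_eq0 andbF.
by move=> i j /(mulfI ik0) E; apply: val_inj; apply: omega_inj E => //.
Qed.

(** With h = 1/(1 + A), |a_i - a_j| h <= 2A/(1 + A) < 2 pi, a range on which [cexp] separates the
    points a_i h. *)
Lemma sampling_step : exists2 h : R, 0 < h &
  injective (fun i => cexp (exponent i * h%:C)).
Proof.
pose A := \sum_(i < 2 * m) normc (exponent i).
have A0 : 0 <= A by apply: sumr_ge0 => i _; exact: normc_ge0.
have Ai i : normc (exponent i) <= A.
  by rewrite /A (bigD1 i) //= lerDl sumr_ge0 // => j _; exact: normc_ge0.
exists (1 + A)^-1; first by rewrite invr_gt0; lra.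
have h0 : 0 < (1 + A)^-1 :> R by rewrite invr_gt0; lra.
move=> i j /cexp_inj H; apply: exponent_inj.
apply: (mulIf (_ : (1 + A)^-1%:C != 0)); last apply: H.
  by rewrite eq_complex /= eqxx andbT gt_eqF.
rewrite -mulrBl; apply: le_lt_trans (ler_Im_normc _) _.
rewrite normcM normc_real gtr0_norm // ltr_pdivrMr; last lra.
have p2 := pi_ge2 R.
have := normcD (exponent i) (- exponent j); rewrite normc_opp.
have := Ai i; have := Ai j; nra.
Qed.

Let basis : 'M[R[i]]_(2 * m) := \matrix_(j, i) exponent i ^+ j.

(** Coordinates of the jet (w, w', ..., w^(2m-1)) at x in the basis of the jets (1, a, a^2, ...) of
    the exponentials at 0. Row 0 of [modal_coordK] writes w as the sum of its coordinates. *)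
Definition modal_coord w i x : R[i] := \sum_j (invmx basis) i j * half_derivn j w x.

Lemma modal_coordK w j x :
  half_derivn j w x = \sum_(i < 2 * m) exponent i ^+ j * modal_coord w i x.
Proof.
have : \col_j half_derivn j w x = basis *m (invmx basis *m \col_j half_derivn j w x).
  by rewrite mulKVmx // Vandermonde_unit //; exact: exponent_inj.
move=> /matrixP/(_ j 0); rewrite !mxE => ->; apply: eq_bigr => i _.
by rewrite !mxE; congr (_ * _); apply: eq_bigr => l _; rewrite mxE.
Qed.

Variable p : nat -> nat -> nat -> R[i].
Hypothesis hp : p_summable m p.

(** C comes before w: it depends on k and p only, which makes the point x0 of [stable_solution_eq0]
    common to all solutions. *)
Lemma solution_system : exists2 C : R, 0 <= C & forall w, solves m p k w ->
  exists r : 'I_(2 * m) -> R -> R[i], forall i x, 0 < x ->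
    is_cderive (modal_coord w i) x (exponent i * modal_coord w i x + r i x) /\
    normc (r i x) <= C * expR (- x) * \sum_l normc (modal_coord w l x).
Proof.
have [K K0 HK] := pcoef_bound k hp.
(* b bounds the change of basis, and c the passage from modal coordinates to the derivatives
   multiplied by the p_gamma. *)
pose b : R := \sum_i \sum_j normc (invmx basis i j).
pose c : R := \sum_(gamma < (2 * m).-1) \sum_(i < 2 * m) normc (exponent i) ^+ gamma.
have c0 : 0 <= c.
  by do 2!(apply: sumr_ge0 => ? _); rewrite exprn_ge0 ?normc_ge0.
have b0 : 0 <= b by do 2!(apply: sumr_ge0 => ? _); rewrite normc_ge0.
exists (b * (K * c)); first by rewrite !mulr_ge0.
move=> w [dw ew].
(* The contribution of the p_gamma to w^(2m) when the equation is solved for it; (-1)^m is its own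
   inverse. *)
pose g x := - (-1) ^+ m *
  \sum_(gamma < (2 * m).-1) pcoef m p gamma x k * half_derivn gamma w x.
have lastE x : 0 <= x ->
    half_derivn (2 * m) w x =
    \sum_(i < 2 * m) exponent i ^+ (2 * m) * modal_coord w i x + g x.
  move=> x0; have := ew x x0; rewrite /lexpr.
  have -> : w x = \sum_i modal_coord w i x.
    have m20 : (0 < 2 * m)%N by rewrite muln_gt0.
    rewrite -[w x]/(half_derivn (Ordinal m20) w x) modal_coordK.
    by apply: eq_bigr => i _; rewrite expr0 mul1r.
  have -> : \sum_(i < 2 * m) exponent i ^+ (2 * m) * modal_coord w i x =
      (-1) ^+ m * k ^+ (2 * m) * \sum_i modal_coord w i x.
    by rewrite mulr_sumr; apply: eq_bigr => i _; rewrite exponent_pow.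
  rewrite /g; move: (half_derivn _ _ _) (\sum_(i < _) _) (\sum_(i < _) _).
  move=> D W G E.
  have s2 : (-1) ^+ m * (-1) ^+ m = 1 :> R[i] by rewrite -exprMn mulrNN mulr1 expr1n.
  have : (-1) ^+ m * ((-1) ^+ m * D + G - k ^+ (2 * m) * W) = 0 by rewrite E mulr0.
  rewrite mulrBr mulrDr !mulrA s2 mul1r => /eqP; rewrite subr_eq0 => /eqP E'.
  by rewrite mulNr -E' addrK.
have stepE j x : 0 <= x -> half_derivn j.+1 w x =
    \sum_(i < 2 * m) exponent i ^+ j * (exponent i * modal_coord w i x) +
    (j.+1 == (2 * m)%N)%:R * g x.
  move=> x0.
  under eq_bigr do rewrite mulrA -exprSr.
  have [->|jm] := eqVneq; first by rewrite mul1r lastE.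
  have jm' : (j.+1 < 2 * m)%N by rewrite ltn_neqAle jm ltn_ord.
  by rewrite mul0r addr0 -(modal_coordK w (Ordinal jm')).
have gle x : 0 <= x ->
    normc (g x) <= K * c * expR (- x) * \sum_l normc (modal_coord w l x).
  move=> x0; rewrite /g normcM normc_opp normcX normc_opp normc1 expr1n mul1r.
  apply: le_trans (normc_sum _ _ _) _.
  rewrite (_ : K * c * _ * _ = c * (K * expR (- x) * \sum_l normc (modal_coord w l x)));
    last ring.
  rewrite /c mulr_suml; apply: ler_sum => gamma _.
  have gm : (gamma < 2 * m)%N by apply: leq_trans (ltn_ord gamma) (leq_pred _).
  rewrite normcM [leRHS]mulrC -[leRHS]mulrA; apply: ler_pM; rewrite ?normc_ge0 ?HK //.
  rewrite (modal_coordK w (Ordinal gm)); apply: le_trans (normc_sum _ _ _) _.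
  rewrite mulrC mulr_suml; apply: ler_sum => i _.
  rewrite normcM normcX ler_wpM2l ?exprn_ge0 ?normc_ge0 //.
  by rewrite (bigD1 i) //= lerDl sumr_ge0 // => l _; exact: normc_ge0.
(* Differentiating the jet shifts it, and only its last entry, w^(2m), involves the perturbation. *)
pose r i x := \sum_j invmx basis i j * ((j.+1 == (2 * m)%N)%:R * g x).
exists r => i x x0; split.
  have x0' := ltW x0.
  have [H1 H2] : is_chder (modal_coord w i) x (exponent i * modal_coord w i x + r i x).
    have -> : exponent i * modal_coord w i x + r i x =
        \sum_j invmx basis i j * half_derivn j.+1 w x.
      under [RHS]eq_bigr do rewrite stepE // mulrDr.
      rewrite big_split /=; congr (_ + _).
      have : \col_l (exponent l * modal_coord w l x) = invmx basis *m (basis *m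
          \col_l (exponent l * modal_coord w l x)).
        by rewrite mulKmx // Vandermonde_unit //; exact: exponent_inj.
      move=> /matrixP/(_ i 0); rewrite !mxE => ->; apply: eq_bigr => j _.
      by rewrite !mxE; congr (_ * _); apply: eq_bigr => l _; rewrite !mxE.
    apply: is_chder_comb => j; rewrite /half_derivn iterS.
    by apply: half_derivableP; apply: dw.
  by split; apply: is_hder_derive.
have x0' := ltW x0.
rewrite /r; apply: le_trans (normc_sum _ _ _) _.
apply: (@le_trans _ _ (b * normc (g x))); last first.
  by rewrite -!mulrA ler_wpM2l // !mulrA gle.
rewrite /b [X in _ <= X * _](bigD1 i) //= [leRHS]mulrDl ler_wpDr //.
  rewrite mulr_ge0 ?normc_ge0 // !sumr_ge0 // => ? _.
  by rewrite sumr_ge0 // => ? _; exact: normc_ge0.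
rewrite mulr_suml; apply: ler_sum => j _.
rewrite normcM ler_wpM2l ?normc_ge0 // normcM ler_piMl ?normc_ge0 //.
by case: (j.+1 == (2 * m)%N); rewrite ?normc1 ?normc0.
Qed.

Hypothesis re_neq0 : forall i, Re (exponent i) != 0.

(** Without decaying coordinates the quadratic form is a sum of squares over the growing modes, so
    being at most 0 it forces z = 0 at x0. Since x0 comes before w, the conditions at x0 can be
    imposed on a combination still to be chosen. *)
Lemma stable_solution_eq0 : exists2 x0 : R, 0 < x0 & forall w,
  solves m p k w -> square_tame w ->
  (forall i, Re (exponent i) < 0 -> modal_coord w i x0 = 0) ->
  forall x, 0 <= x -> w x = 0.
Proof.
have [C C0 HC] := solution_system.
have [h h0 hinj] := sampling_step.
have [d d0 Hd] := @positive_lower_bound R _ (fun i => `|Re (exponent i)|) ltac:(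
  by move=> i; rewrite normr_gt0).
pose s i : R := if Re (exponent i) < 0 then -1 else 1.
have s1 i : `|s i| <= 1 by rewrite /s; case: ifP; rewrite ?normrN normr1.
have sd i : d <= s i * Re (exponent i).
  apply: le_trans (Hd i) _; rewrite /s.
  have [H|H] := ltP; first by rewrite mulN1r ltr0_norm.
  by rewrite mul1r ger0_norm.
have [X X0 HX] := @expRN_small R (d / (2 * C * (2 * m)%:R + 1)) ltac:(
  by rewrite divr_gt0 // ltr_wpDl // !mulr_ge0).
exists X => // w sw tw w0.
have [r Hr] := HC w sw.
have wE x : w x = \sum_i modal_coord w i x.
  have m20 : (0 < 2 * m)%N by rewrite muln_gt0.
  rewrite -[w x]/(half_derivn (Ordinal m20) w x) modal_coordK.
  by apply: eq_bigr => i _; rewrite expr0 mul1r.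
have small : 2 * C * (2 * m)%:R * expR (- X) <= d.
  have C2 : 0 <= 2 * C * (2 * m)%:R by rewrite !mulr_ge0.
  have := HX X (lexx _); rewrite ler_pdivlMr; last by rewrite ltr_wpDl.
  have := expR_ge0 (- X); nra.
have cone := tame_cone C0 (fun i x (xp : 0 < x) => (Hr i x xp).1)
  (fun i x (xp : 0 < x) => (Hr i x xp).2)
  (fun x _ => wE x) h0 hinj s1 sd X0 small tw.
have zX i : modal_coord w i X = 0.
  move: cone; rewrite (eq_bigr (fun i => normc (modal_coord w i X) ^+ 2)); last first.
    move=> j _; rewrite /s; case: ifP => H; last by rewrite mul1r.
    by rewrite w0 // normc0 expr0n mulr0.
  move=> N0; have : \sum_i normc (modal_coord w i X) ^+ 2 == 0.
    by rewrite eq_le N0 sumr_ge0 // => j _; rewrite sqr_ge0.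
  rewrite psumr_eq0 => [|j _]; last exact: sqr_ge0.
  by move=> /allP/(_ i)/(_ (mem_index_enum _)); rewrite sqrf_eq0 normc_eq0 => /eqP.
have wpos x : 0 < x -> w x = 0.
  move=> x0; rewrite wE big1 // => i _.
  exact: (vanishing_propagates C0 (fun i x (xp : 0 < x) => (Hr i x xp).1)
    (fun i x (xp : 0 < x) => (Hr i x xp).2) X0 zX).
(* The system is available on x > 0 only; the value at 0 follows by one-sided continuity. *)
move=> x; rewrite le_eqVlt => /predU1P[<-|]; last exact: wpos.
have [dw _] := sw.
have m20 : (0 < 2 * m)%N by rewrite muln_gt0.
have /half_derivableP[D1 D2] := dw _ _ m20 (lexx 0).
have H (g : R -> R) : g t @[t --> within `[0, +oo[ (nbhs (0 : R))] --> g 0 ->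
    (forall t : R, 0 < t -> g t = 0) -> g 0 = 0.
  move=> Hg gp; apply/eqP; apply: contraT => g0.
  have g0' : 0 < `|g 0| by rewrite normr_gt0.
  move/cvgrPdist_lt/(_ _ g0'): Hg; rewrite near_withinE => -[e /= e0 He].
  have e2 : 0 < e / 2 by rewrite divr_gt0.
  have := He (e / 2); rewrite /= sub0r normrN gtr0_norm // (gp _ e2) subr0 ltxx.
  apply => //.
    by rewrite ltr_pdivrMr // ltr_pMr // ltr1n.
  by rewrite in_itv /= andbT ltW.
apply: complexP => /=.
  by apply: (H _ (is_hder_cts (lexx 0) D1)) => t t0 /=; rewrite wpos.
by apply: (H _ (is_hder_cts (lexx 0) D2)) => t t0 /=; rewrite wpos.
Qed.

End StableSolutions.

(** * Square integrability and asymptotics *)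

Section SquareIntegrable.
Context {R : realType}.
Local Notation Re := (@complex.Re R).
Local Notation Im := (@complex.Im R).
Local Notation mu := (@lebesgue_measure R).
Implicit Types (x : R) (y : R -> R[i]).

Lemma square_tameZ y c : square_tame y -> square_tame (fun x => c * y x).
Proof.
move=> [F [dF [B H]]]; exists (fun x => normc c ^+ 2 * F x).
exists (fun x => normc c ^+ 2 * dF x), (normc c ^+ 2 * B) => x x0.
have [H1 H2 H3] := H x x0; split; first exact: is_derive_scalef.
  by rewrite normcM exprMn ler_wpM2l ?sqr_ge0.
by rewrite ler_wpM2l ?sqr_ge0.
Qed.

Lemma square_tameD y1 y2 : square_tame y1 -> square_tame y2 ->
  square_tame (fun x => y1 x + y2 x).
Proof.
move=> [F1 [dF1 [B1 K1]]] [F2 [dF2 [B2 K2]]].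
exists (fun x => 2 * F1 x + 2 * F2 x), (fun x => 2 * dF1 x + 2 * dF2 x).
exists (2 * B1 + 2 * B2) => x x0.
have [H1 H2 H3] := K1 x x0; have [H4 H5 H6] := K2 x x0; split; last lra.
  by apply: is_derive_addf; apply: is_derive_scalef.
have := normcD (y1 x) (y2 x).
have := normc_ge0 (y1 x); have := normc_ge0 (y2 x); have := normc_ge0 (y1 x + y2 x).
have := sqr_ge0 (normc (y1 x) - normc (y2 x)).
move: (normc _) (normc _) (normc _) H2 H5 => a b c; nra.
Qed.

Lemma square_tame_comb (I : Type) (r : seq I) (c : I -> R[i]) (g : I -> R -> R[i]) :
  (forall i, square_tame (g i)) -> square_tame (fun x => \sum_(i <- r) c i * g i x).
Proof.
move=> H; elim: r => [|i r IH].
  exists (fun=> 0), (fun=> 0), 0 => x _; split => //.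
    exact: is_derive_cst.
  by rewrite big_nil normc0 expr0n.
under eq_fun do rewrite big_cons.
by apply: square_tameD => //; exact: square_tameZ.
Qed.

Lemma half_derivable_cts y x : 0 <= x -> half_derivable y x ->
  Re (y t) @[t --> within `[0, +oo[ (nbhs x)] --> Re (y x) /\
  Im (y t) @[t --> within `[0, +oo[ (nbhs x)] --> Im (y x).
Proof.
by move=> x0 /half_derivableP[H1 H2]; split;
  [exact: (is_hder_cts x0 H1)|exact: (is_hder_cts x0 H2)].
Qed.

Lemma in_L2_square_tame y : (forall x, 0 <= x -> half_derivable y x) -> in_L2 y ->
  square_tame y.
Proof.
move=> dy [mRe mIm Ifin]; set g := fun x => normc (y x) ^+ 2.
have gE : g = (fun x => Re (y x) * Re (y x) + Im (y x) * Im (y x)).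
  by apply/funext => x; rewrite /g sqr_normcE !expr2.
have g0 x : 0 <= g x by rewrite sqr_ge0.
have mg : measurable_fun (`[0, +oo[ : set R) g.
  by rewrite gE; apply: measurable_funD; apply: measurable_funM.
have ig : mu.-integrable `[0, +oo[ (EFin \o g).
  apply/integrableP; split; first exact/measurable_EFinP.
  apply: le_lt_trans Ifin; rewrite le_eqVlt; apply/predU1P; left.
  by apply: eq_integral => x _ /=; rewrite ger0_norm.
(* The primitive of |y|^2 from 0, bounded by the integral over the half-line. *)
exists (fun x => \int[mu]_(t in `[0, x]) g t), g,
  (fine (\int[mu]_(t in `[0%R, +oo[) (g t)%:E)%E).
move=> x x0.
have sub u : `[0, u]%classic `<=` (`[0, +oo[ : set R).
  by move=> t /=; rewrite !in_itv /= andbT => /andP[].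
have igu u : mu.-integrable `[0, u] (EFin \o g).
  by apply: integrableS ig => //; exact: sub.
split => //.
  (* The endpoint x + 1 only makes x an interior point. *)
  have [| |D1 D2] := @continuous_FTC1_closed R g 0 x (x + 1) _ (igu _) x0 _.
  - by rewrite ltrDl.
  - have [H1 H2] := half_derivableP (dy x (ltW x0)).
    have := is_hder_derive x0 H1 => D1; have := is_hder_derive x0 H2 => D2.
    rewrite gE; apply/differentiable_continuous/derivable1_diffP.
    have := is_derive_addf (is_derive_mulf D1 D1) (is_derive_mulf D2 D2) => D.
    exact: ex_derive.
  - by apply: DeriveDef => //; rewrite -derive1E.
rewrite /Rintegral fine_le //.
- exact: (integrable_fin_num _ (igu x)).
- exact: (integrable_fin_num _ ig).
- apply: ge0_subset_integral => //; last by move=> t _; rewrite lee_fin.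
  by case/integrableP: ig.
Qed.

Lemma decay_in_L2 y (C delta : R) : (forall x, 0 <= x -> half_derivable y x) ->
  0 < delta -> (forall x, 0 <= x -> normc (y x) <= C * expR (- delta * x)) -> in_L2 y.
Proof.
move=> dy d0 Hy.
have mm (g : R -> R) :
    (forall x, 0 <= x -> g t @[t --> within `[0, +oo[ (nbhs x)] --> g x) ->
    measurable_fun (`[0, +oo[ : set R) g.
  move=> H; apply: subspace_continuous_measurable_fun => //.
  by apply/subspace_continuousP => x /=; rewrite in_itv /= andbT; exact: H.
have mRe : measurable_fun (`[0, +oo[ : set R) (fun x => Re (y x)).
  by apply: mm => x x0; have [] := half_derivable_cts x0 (dy x x0).
have mIm : measurable_fun (`[0, +oo[ : set R) (fun x => Im (y x)).
  by apply: mm => x x0; have [] := half_derivable_cts x0 (dy x x0).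
have gE : (fun x => normc (y x) ^+ 2) =
    (fun x => Re (y x) * Re (y x) + Im (y x) * Im (y x)).
  by apply/funext => x; rewrite sqr_normcE !expr2.
have mg : measurable_fun (`[0, +oo[ : set R) (fun x => normc (y x) ^+ 2).
  by rewrite gE; apply: measurable_funD; apply: measurable_funM.
split => //.
pose r := 2 * delta; have r0 : 0 < r by rewrite mulr_gt0.
(* The majorant C^2 e^{-2 delta x} is a multiple of the exponential density of rate r = 2 delta. *)
have ie : mu.-integrable `[0, +oo[
    (fun x => (C ^+ 2 / r)%:E * (exponential_pdf r x)%:E)%E.
  apply: integrableZl => //; apply: integrableS (integrable_exponential_pdf r0) => //.
have : mu.-integrable `[0, +oo[ (fun x => (normc (y x) ^+ 2)%:E).
  apply: (le_integrable _ _ _ ie) => //; first exact/measurable_EFinP.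
  move=> x /=; rewrite in_itv /= andbT => x0.
  rewrite lee_fin !ger0_norm ?sqr_ge0 //; last first.
    by rewrite mulr_ge0 ?divr_ge0 ?sqr_ge0 ?(ltW r0) // exponential_pdf_ge0 // ltW.
  rewrite exponential_pdfE // mulrA divfK ?gt_eqF //.
  have -> : expR (- r * x) = expR (- delta * x) ^+ 2.
    by rewrite -expRM_natl; congr expR; rewrite /r; ring.
  rewrite -exprMn ler_pXn2r ?nnegrE ?normc_ge0 ?Hy //.
  by apply: le_trans (Hy x x0); exact: normc_ge0.
move=> /integrableP[_]; apply: le_lt_trans; rewrite le_eqVlt; apply/predU1P; left.
by apply: eq_integral => x _ /=; rewrite ger0_norm // sqr_ge0.
Qed.

Lemma half_derivn_eq0 y : (forall x, 0 <= x -> y x = 0) ->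
  forall n x, 0 <= x -> half_derivn n y x = 0.
Proof.
move=> y0; elim=> [|n IH] x x0; first exact: y0.
rewrite /half_derivn iterS; apply: (proj2 (is_chderP x0 _)).
by apply: (@eq_is_chder _ (fun=> 0)) (is_chder0 x) => // t t0; rewrite -(IH t t0).
Qed.

End SquareIntegrable.

(** * Combinations of solutions, geometry of the sectors, independence from asymptotics *)

Section Eigenvalues.
Context {R : realType}.
Variable m : nat.
Hypothesis m1 : (1 <= m)%N.
Local Notation Re := (@complex.Re R).
Local Notation Im := (@complex.Im R).

Lemma solves_comb (p : nat -> nat -> nat -> R[i]) k n (c : 'I_n -> R[i])
    (g : 'I_n -> R -> R[i]) : (forall i, solves m p k (g i)) ->
  let w x := \sum_i c i * g i x in
  solves m p k w /\ forall j x, (j <= 2 * m)%N -> 0 <= x ->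
    half_derivn j w x = \sum_i c i * half_derivn j (g i) x.
Proof.
move=> H w.
have [dw Ew] := half_derivn_comb (index_enum 'I_n) c (fun i => (H i).1).
split=> //; split=> // x x0.
transitivity (\sum_i c i * lexpr m p k (g i) x); last first.
  by rewrite big1 // => i _; rewrite (H i).2 // mulr0.
rewrite /lexpr Ew //.
under [X in _ + X - _]eq_bigr => gamma _.
  rewrite Ew //; last by apply: leq_trans (ltnW (ltn_ord gamma)) (leq_pred _).
  over.
under [RHS]eq_bigr do rewrite mulrBr mulrDr.
rewrite sumrB big_split /=; congr (_ + _ - _).
- by rewrite mulr_sumr; apply: eq_bigr => i _; rewrite mulrCA.
- under eq_bigr do rewrite mulr_sumr.
  under [RHS]eq_bigr do rewrite mulr_sumr.
  rewrite exchange_big /=; apply: eq_bigr => i _; apply: eq_bigr => gamma _.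
  by rewrite mulrCA.
- by rewrite mulr_sumr; apply: eq_bigr => i _; rewrite mulrCA.
Qed.

(** The zeros of sine are multiples of pi, hence of pi/m, and none lies strictly between consecutive
    multiples of pi/m. Writing N = q m + s with s < m, the shift by q pi brings phi into ]0, pi[. *)
Lemma sin_neq0 (N : nat) (phi : R) :
  N%:R * pi / m%:R < phi -> phi < N.+1%:R * pi / m%:R -> sin phi != 0.
Proof.
have m0 : 0 < m%:R :> R by rewrite ltr0n.
have p0 := pi_gt0 R.
rewrite ltr_pdivrMr // ltr_pdivlMr //.
have sinpn (q : nat) (x : R) : (sin (x + q%:R * pi) == 0) = (sin x == 0).
  elim: q => [|q IH]; first by rewrite mul0r addr0.
  by rewrite -natr1 mulrDl mul1r addrA sinDpi oppr_eq0.
rewrite (divn_eq N m); have := ltn_mod N m; rewrite m1.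
move: (N %/ m)%N (N %% m)%N => q s sm.
rewrite -addnS !natrD !natrM => H1 H2.
rewrite -(subrK (q%:R * pi) phi) sinpn.
have sm' : s.+1%:R <= m%:R :> R by rewrite ler_nat.
have s0 : 0 <= s%:R :> R by [].
rewrite gt_eqF // sin_gt0_pi //; apply/andP; split.
  by rewrite -(ltr_pM2r m0) mul0r; nra.
by rewrite -(ltr_pM2r m0); nra.
Qed.

(** Multiplication by omega_tau adds tau pi/m to the argument, which then lies in the open interval
    of index nu + tau. *)
Lemma sector_Im_neq0 nu (k : R[i]) tau : sector m nu k -> Im (k * omega m tau) != 0.
Proof.
move=> [r [theta [r0 t1 t2 ->]]]; rewrite -mulrA /omega -cexpD -mulrDr -rmorphD.
have -> z : Im (r%:C * z) = r * Im z by rewrite Im_mul /= mul0r addr0.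
rewrite mulf_neq0 ?(gt_eqF r0) //.
rewrite /cexp Re_mul Im_mul /= !(mul0r, mulr0, mul1r, add0r, addr0, subr0, oppr0, expR0).
have m0 : 0 < m%:R :> R by rewrite ltr0n.
apply: (@sin_neq0 (nu + tau)).
  by rewrite natrD !mulrDl ltrD2r.
by rewrite -addSn natrD !mulrDl ltrD2r.
Qed.

Lemma sector_neq0 nu (k : R[i]) : sector m nu k -> k != 0.
Proof.
move=> [r [theta [r0 _ _ ->]]]; rewrite mulf_neq0 ?cexp_neq0 //.
by rewrite eq_complex /= gt_eqF.
Qed.

Lemma Re_exponent (k : R[i]) tau : Re (exponent m k tau) = - Im (k * omega m tau).
Proof. by rewrite /exponent -mulrA Re_mul /= mul0r mul1r sub0r. Qed.

(** Each error is small relative to its own exponential, so different decay rates need no ordering: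
    with S x the sum of the |c_i e^{a_i x}|, sampling the zero combination yields S x <= const
    e^{-x} S x, and S vanishes at a large x. *)
Lemma asymptotics_independent n (f : 'I_n -> R -> R[i]) (a : 'I_n -> R[i]) (h : R)
    (c : 'I_n -> R[i]) :
  0 < h -> injective (fun i => cexp (a i * h%:C)) -> (forall i, Re (a i) <= 0) ->
  (forall i, exists2 K : R, 0 <= K & forall x, 0 <= x ->
     normc (f i x - cexp (a i * x%:C)) <= K * expR ((Re (a i) - 1) * x)) ->
  (forall x, 0 <= x -> \sum_i c i * f i x = 0) -> forall i, c i = 0.
Proof.
move=> h0 hinj a0 /fin_all_exists2[K K0 HK] c0 i.
have [M M0 HM] := invertible_coercive (Vandermonde_unit hinj).
pose KK := \sum_i K i.
have KK0 : 0 <= KK by exact: sumr_ge0.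
pose v x i := c i * cexp (a i * x%:C).
pose S x := \sum_i normc (v x i).
have S0 x : 0 <= S x by apply: sumr_ge0 => j _; exact: normc_ge0.
have err x (j : 'I_n) : 0 <= x ->
    normc (\sum_i cexp (a i * h%:C) ^+ j * v x i) <= KK * expR (- x) * S x.
  move=> x0; have jh : 0 <= j%:R * h by rewrite mulr_ge0 // ltW.
  have xj : 0 <= x + j%:R * h by rewrite addr_ge0.
  have -> : \sum_i cexp (a i * h%:C) ^+ j * v x i =
      \sum_i - (c i * (f i (x + j%:R * h) - cexp (a i * (x + j%:R * h)%:C))).
    rewrite sumrN; under [X in _ = - X]eq_bigr do rewrite mulrBr.
    rewrite sumrB c0 // sub0r opprK; apply: eq_bigr => l _.
    rewrite /v -cexpX mulrCA -cexpD; congr (_ * cexp _).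
    by rewrite rmorphD rmorphM rmorph_nat mulrDr addrC mulrCA mulr_natl.
  apply: le_trans (normc_sum _ _ _) _; rewrite mulr_sumr; apply: ler_sum => l _.
  rewrite normc_opp /v !normcM mulrCA ler_wpM2l ?normc_ge0 //.
  apply: le_trans (HK _ _ xj) _; rewrite normc_cexp -mulrA.
  apply: ler_pM; rewrite ?expR_ge0 //.
    by rewrite /KK (bigD1 l) //= lerDl sumr_ge0.
  rewrite -expRD ler_expR Re_mul /= mulr0 subr0.
  (* As Re (a l) <= 0, the shift by j h only decreases e^{(Re (a l) - 1) x}. *)
  have := a0 l; nra.
have Sle x : 0 <= x -> S x <= M * (n%:R * (KK * expR (- x) * S x)).
  move=> x0; apply: le_trans (HM (v x)) _; rewrite ler_wpM2l //.
  apply: (@le_trans _ _ (\sum_(j < n) KK * expR (- x) * S x)).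
    by apply: ler_sum => j _; under eq_bigr do rewrite mxE; exact: err.
  by rewrite sumr_const card_ord [leRHS]mulr_natl.
have P0 : 0 <= 2 * (M * n%:R * KK) by rewrite !mulr_ge0.
have [X X0 HX] := @expRN_small R (1 / (2 * (M * n%:R * KK) + 1)) ltac:(
  by rewrite divr_gt0 // ltr_wpDl).
have SX : S X = 0.
  apply/eqP; rewrite eq_le S0 andbT.
  have := HX X (lexx _); rewrite ler_pdivlMr; last by rewrite ltr_wpDl.
  have := Sle X (ltW X0); have := expR_ge0 (- X); have := S0 X.
  set e := expR _; move=> s0 e0 H1 H2.
  have : e * (M * n%:R * KK) <= 1 / 2 by lra.
  move=> /(ler_wpM2r s0); lra.
move/eqP: SX; rewrite psumr_eq0 => [|j _]; last exact: normc_ge0.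
move=> /allP/(_ i)/(_ (mem_index_enum _)); rewrite normc_eq0 mulf_eq0.
by rewrite (negbTE (cexp_neq0 _)) orbF => /eqP.
Qed.

End Eigenvalues.

(** * The eigenvalue criterion *)

Section EigenvalueCriterion.
Context {R : realType}.
Variable m : nat.
Hypothesis m1 : (1 <= m)%N.
Local Notation Re := (@complex.Re R).
Local Notation Im := (@complex.Im R).

Variable p : nat -> nat -> nat -> R[i].
Hypothesis hp : p_summable m p.
Variables (V : nat -> nat -> R[i]) (U : nat -> nat -> nat -> nat -> R[i]).
Hypothesis hf : special_solutions m p V U.
Variables (nu : nat) (t : 'I_m -> 'I_(2 * m)).
Hypothesis ht : decaying_indices (R := R) nu t.
Variable k : R[i].
Hypothesis hk : sector m nu k.

Let f q := fsol m V U (t q) k.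

Let Im_gt0 q : 0 < Im (k * omega m (t q)).
Proof. by rewrite -(ht.2 k hk) codom_f. Qed.

Let f_solves q : solves m p k (f q).
Proof.
apply: (hf (ltn_ord (t q))).2 => n j n1 jm.
exact: (knjt_neq m1 (Im_gt0 q)).
Qed.

Let f_asymp q : exists2 K : R, 0 <= K & forall x : R, 0 <= x ->
  normc (f q x - cexp (exponent m k (t q) * x%:C)) <=
    K * expR ((Re (exponent m k (t q)) - 1) * x).
Proof. exact: (fsol_asymp m1 (hf (ltn_ord (t q))).1 (Im_gt0 q)). Qed.

Let f_independent (c : 'I_m -> R[i]) :
  (forall x : R, 0 <= x -> \sum_q c q * f q x = 0) -> forall q, c q = 0.
Proof.
have [h h0 hinj] := sampling_step m1 (sector_neq0 hk).
apply: (asymptotics_independent (a := fun q => exponent m k (t q)) h0).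
- by move=> q r /hinj /ht.1.
- by move=> q; rewrite Re_exponent oppr_le0 ltW.
- exact: f_asymp.
Qed.

Let solution_derivable w : solves m p k w -> forall x, 0 <= x -> half_derivable w x.
Proof.
move=> [dw _] x; have m20 : (0 < 2 * m)%N by rewrite muln_gt0.
exact: (dw 0%N).
Qed.

Let f_comb_in_L2 (c : 'I_m -> R[i]) : in_L2 (fun x => \sum_q c q * f q x).
Proof.
have [sw _] := solves_comb c f_solves.
have [K K0 HK] := fin_all_exists2 f_asymp.
have [d d0 Hd] := positive_lower_bound Im_gt0.
apply: (@decay_in_L2 _ _ (\sum_q normc (c q) * (1 + K q)) d (solution_derivable sw) d0).
move=> x x0; apply: le_trans (normc_sum _ _ _) _; rewrite mulr_suml.
apply: ler_sum => q _; rewrite normcM -mulrA ler_wpM2l ?normc_ge0 //.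
have := normcD (f q x - cexp (exponent m k (t q) * x%:C))
  (cexp (exponent m k (t q) * x%:C)).
rewrite subrK => H; apply: le_trans H _; rewrite addrC mulrDl mul1r.
have dx : d * x <= Im (k * omega m (t q)) * x by rewrite ler_wpM2r.
apply: lerD.
  by rewrite normc_cexp ler_expR Re_mul /= mulr0 subr0 Re_exponent; lra.
apply: le_trans (HK q x x0) _; rewrite ler_wpM2l //.
by rewrite ler_expR Re_exponent; lra.
Qed.

Lemma Wdet_eq0P : reflect
  (exists2 c : 'I_m -> R[i], ~ (forall q, c q = 0) &
    forall l, (l < m)%N -> \sum_q c q * half_derivn l (f q) 0 = 0)
  (Wdet V U t k == 0).
Proof.
rewrite /Wdet -det_tr; apply: (iffP det0P) => [[v v0 vM]|[c c0 cM]].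
  exists (fun q => v 0 q).
    by move=> H; move/eqP: v0; apply; apply/rowP => q; rewrite H mxE.
  move=> l lm; move/matrixP/(_ 0 (Ordinal lm)): vM; rewrite !mxE => vM.
  by rewrite -[RHS]vM; apply: eq_bigr => q _; rewrite !mxE.
exists (\row_q c q).
  apply/eqP => H; apply: c0 => q; by move/rowP/(_ q): H; rewrite !mxE.
apply/matrixP => i l; rewrite !mxE -[RHS](cM l (ltn_ord l)).
by apply: eq_bigr => q _; rewrite !mxE.
Qed.

Lemma eigenvalue_of_Wdet_eq0 : Wdet V U t k = 0 -> bunch_eigenvalue m p k.
Proof.
move=> /eqP/Wdet_eq0P[c c0 cW].
have [sw Ew] := solves_comb c f_solves.
exists (fun x => \sum_q c q * f q x); split => //.
- apply: contrapT => H; apply: c0; apply: f_independent => x x0.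
  by apply/eqP; apply: contraT => wx; exfalso; apply: H; exists x.
- move=> j jm; rewrite Ew ?cW //.
  by rewrite (leq_trans (ltnW jm)) // leq_pmull.
Qed.

Lemma Wdet_eq0_of_eigenvalue : bunch_eigenvalue m p k -> Wdet V U t k = 0.
Proof.
move=> [y [[x1 x10 yx1] yL2 sy yb]].
have re0 (i : 'I_(2 * m)) : Re (exponent m k i) != 0.
  by rewrite Re_exponent oppr_eq0 (sector_Im_neq0 m1 _ hk).
have [X X0 HX] := stable_solution_eq0 m1 (sector_neq0 hk) hp re0.
pose g (i : 'I_m.+1) := if unlift ord0 i is Some q then f q else y.
have g0 : g ord0 = y by rewrite /g unlift_none.
have gS q : g (lift ord0 q) = f q by rewrite /g liftK.
have sg i : solves m p k (g i) by rewrite /g; case: unliftP.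
have f_L2 q : in_L2 (f q).
  have := f_comb_in_L2 (fun r => (r == q)%:R); congr in_L2; apply/funext => x.
  rewrite (bigD1 q) //= eqxx mul1r big1 ?addr0 // => r /negbTE ->.
  by rewrite mul0r.
have tg i : square_tame (g i).
  apply: in_L2_square_tame; first exact: solution_derivable.
  by rewrite /g; case: unliftP.
(* m + 1 solutions against m decaying coordinates: with more rows than columns, A has a nonzero left
   null vector. *)
pose A := \matrix_(i < m.+1, q < m) modal_coord k (g i) (t q) X.
have : kermx A != 0.
  rewrite -mxrank_eq0 mxrank_ker -lt0n subn_gt0.
  by apply: leq_ltn_trans (rank_leq_col _) _.
move=> /rowV0Pn[v /sub_kermxP vA v0].
have [sw Ew] := solves_comb (fun i => v 0 i) sg.
have w0 x : 0 <= x -> \sum_i v 0 i * g i x = 0.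
  apply: HX sw _ _ x; first exact: square_tame_comb.
  move=> i; rewrite Re_exponent oppr_lt0 -(ht.2 k hk) => /codomP[q ->].
  move/matrixP/(_ 0 q): vA; rewrite !mxE => vA.
  rewrite -[RHS]vA /modal_coord.
  under eq_bigr do rewrite Ew ?(ltW X0) ?(ltnW (ltn_ord _)) // mulr_sumr.
  rewrite exchange_big /=; apply: eq_bigr => l _; rewrite mxE mulr_sumr.
  by apply: eq_bigr => j _; rewrite mulrCA.
apply/eqP/Wdet_eq0P; exists (fun q => v 0 (lift ord0 q)).
  (* If every f_q had coefficient 0, w(x1) = 0 with y(x1) nonzero would make the coefficient of y
     vanish too. *)
  move=> vq0; move/eqP: v0; apply; apply/rowP => i; rewrite mxE.
  case: (unliftP ord0 i) => [q ->|->]; first exact: vq0.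
  have := w0 x1 x10; rewrite big_ord_recl g0 big1; last by move=> q _; rewrite vq0 mul0r.
  by rewrite addr0 => /eqP; rewrite mulf_eq0 (negbTE yx1) orbF => /eqP.
move=> l lm.
have l2 : (l <= 2 * m)%N by rewrite (leq_trans (ltnW lm)) // leq_pmull.
have := Ew l 0 l2 (lexx 0).
(* At 0 the boundary conditions remove y from the derivatives of w, leaving a relation between the
   columns of the determinant. *)
rewrite (half_derivn_eq0 w0) // big_ord_recl g0 yb // mulr0 add0r => E.
by rewrite [RHS]E; apply: eq_bigr => q _; rewrite gS.
Qed.

End EigenvalueCriterion.

Theorem theorem3 (R : realType) (m : nat) (hm : (1 <= m)%N)
  (p : nat -> nat -> nat -> R[i]) (hp : p_summable m p)
  (V : nat -> nat -> R[i]) (U : nat -> nat -> nat -> nat -> R[i])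
  (hf : special_solutions m p V U)
  (nu : nat) (hnu : (nu < 2 * m)%N)
  (t : 'I_m -> 'I_(2 * m)) (ht : decaying_indices (R := R) nu t)
  (k : R[i]) (hk : sector m nu k) (hIm : complex.Im k != 0) :
  bunch_eigenvalue m p k <-> Wdet V U t k = 0.
Proof.
split; first exact: (Wdet_eq0_of_eigenvalue hm hp hf ht hk).
exact: (eigenvalue_of_Wdet_eq0 hm hf ht hk).
Qed.
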